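(* Let $X=V\big(\sum_{i=0}^5 x_i^3\big)\subset\mathbb{P}^5$ be the Fermat cubic fourfold over $\mathbb{C}$, $F$ its Fano scheme of lines, $S\subset F$ the locus of lines of second type, and $W\subset X$ the locus spanned by lines of second type. Then \[ W=\bigcup_{i,j,k}V_{i,j,k}\ \cup\ \bigcup_{i,j}V_{i,j},\qquad S=\bigcup_{i,j,k}S_{i,j,k}\ \cup\ \bigcup_{i,j,\mu}S_{i,j}^{(\mu)}, \] where the unions are over all 3-element subsets $\{i,j,k\}$, respectively all 2-element subsets $\{i,j\}$, of $\{0,\dots,5\}$, and $\mu\in\{1,2,3\}$. Moreover, with $q:\mathbb{L}\to F$ the universal family of lines and $p:\mathbb{L}\to X$ the natural morphism, the morphism $p|_{q^{-1}(S)}:q^{-1}(S)\to W$ is generically of degree one (onto its image) when restricted to the part $q^{-1}(S')$ over any one $S'$ of the $55=3\cdot15+10$ irreducible components $S_{i,j,k}$, $S_{i,j}^{(\mu)}$ of $S$.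
   Context: A line $\ell\subset X$ in a smooth cubic fourfold is of second type if $N_{\ell/X}\cong\mathcal{O}(-1)\oplus\mathcal{O}(1)^{\oplus2}$; equivalently, there is a linear $\mathbb{P}^3\subset\mathbb{P}^5$ containing $\ell$ and tangent to $X$ at every point of $\ell$. $\mathbb{L}=\{([\ell],x):x\in\ell\}\subset F\times X$, with projections $q,p$, and $W=p(q^{-1}(S))$. For $\{i,j,k\}\subset\{0,\dots,5\}$ with complement $\{i',j',k'\}$ put $V_{i,j,k}=V(x_i^3+x_j^3+x_k^3)\subset X$ (so $V_{i,j,k}=V_{i',j',k'}$, giving 10 distinct hypersurfaces), $C_{i,j,k}=V_{i,j,k}\cap V(x_{i'},x_{j'},x_{k'})$ and $C'_{i,j,k}=V_{i',j',k'}\cap V(x_i,x_j,x_k)$; these are Fermat plane cubics in disjoint planes and $V_{i,j,k}=\mathrm{Join}(C_{i,j,k},C'_{i,j,k})$. $S_{i,j,k}\subset F$ is the locus of ruling lines of this join, i.e. of lines joining a point of $C_{i,j,k}$ to a point of $C'_{i,j,k}$. For $\{i,j\}\subset\{0,\dots,5\}$ with complement $\{i',i'',j',j''\}$ put $V_{i,j}=V(x_i^3+x_j^3)\subset X$ (15 distinct hypersurfaces), $G_{i,j}=V(x_{i'}^3+x_{i''}^3+x_{j'}^3+x_{j''}^3,\,x_i,\,x_j)$ (a Fermat cubic surface), and $\{p_{i,j}^{(1)},p_{i,j}^{(2)},p_{i,j}^{(3)}\}=V(x_i^3+x_j^3,x_{i'},x_{i''},x_{j'},x_{j''})$; then $V_{i,j}=\mathrm{Join}(G_{i,j},\{p_{i,j}^{(1)},p_{i,j}^{(2)},p_{i,j}^{(3)}\})$.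 $S_{i,j}^{(\mu)}\subset F$ is the locus of ruling lines of $\mathrm{Join}(G_{i,j},\{p_{i,j}^{(\mu)}\})$, i.e. of lines joining $p_{i,j}^{(\mu)}$ to a point of $G_{i,j}$. *)

(* Defs.v *)
From HB Require Import structures.
From mathcomp Require Import all_boot all_order all_algebra.
From mathcomp Require Import mpoly complex.
From mathcomp Require Import classical_sets cardinality reals.

Set Implicit Arguments.
Unset Strict Implicit.
Unset Printing Implicit Defensive.

Import GRing.Theory.
Local Open Scope classical_set_scope.
Local Open Scope ring_scope.

Section ProjectiveGeometry.
Variable K : closedFieldType.

(* Linear subspaces of P^(n-1) are subspaces of K^n: a point is a subspace of
   (vector) dimension 1, a line one of dimension 2, and x lies on l when
   (x <= l)%VS.  Varieties are identified with their sets of closed points. *)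
Definition linsp (n : nat) : Type := {vspace 'rV[K]_n}.

Definition poly_map n (s : 'I_n -> {mpoly K[n]}) (x : 'rV[K]_n) : 'rV[K]_n :=
  \row_i (s i).@[x 0].

(* V(I).  As K is infinite, P vanishes on all representatives of x iff all
   homogeneous components of P vanish at x, so I need not consist of
   homogeneous polynomials. *)
Definition zeros n (I : set {mpoly K[n]}) : set (linsp n) :=
  [set x | \dim x = 1%N /\
     forall P (v : 'rV[K]_n), I P -> v \in x -> P.@[v 0] = 0].

Definition proj_closed n (Z : set (linsp n)) : Prop :=
  exists I : set {mpoly K[n]}, Z = zeros I.

Definition proj_dense_in n (A Z : set (linsp n)) : Prop :=
  A `<=` Z /\ forall B, proj_closed B -> A `<=` B -> Z `<=` B.

(* u /\ v; as u and v range over a line l, these are exactly the multiples of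
   the Pluecker coordinate vector of l. *)
Definition pluecker n (u v : 'rV[K]_n) : 'M[K]_n :=
  \matrix_(i, j) (u 0 i * v 0 j - u 0 j * v 0 i).

(* Zariski closed subsets of the Grassmannian of lines in its Pluecker
   embedding. *)
Definition grass_closed n (Z : set (linsp n)) : Prop :=
  exists I : set {mpoly K[n * n]},
    Z = [set l | \dim l = 2%N /\
          forall P (u v : 'rV[K]_n), I P -> u \in l -> v \in l ->
            P.@[mxvec (pluecker u v) 0] = 0].

Definition irreducible T (closed : set (set T)) (Z : set T) : Prop :=
  Z !=set0 /\ forall A B, closed A -> closed B ->
    Z `<=` A `|` B -> Z `<=` A \/ Z `<=` B.

Definition irreducible_components T (closed : set (set T)) (S : set T) :
    set (set T) :=
  [set Z | [/\ Z `<=` S, irreducible closed Z &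
     forall Z', Z' `<=` S -> irreducible closed Z' -> Z `<=` Z' -> Z' = Z]].

Section Hypersurface.
Variables (n : nat) (f : {mpoly K[n]}).

Definition hypersurface : set (linsp n) := zeros [set f].

Definition fano : set (linsp n) :=
  [set l | \dim l = 2%N /\ forall v : 'rV[K]_n, v \in l -> f.@[v 0] = 0].

(* The pairs (l, x), with projections fst = q and snd = p. *)
Definition universal_line : set (linsp n * linsp n) :=
  [set lx | [/\ fano lx.1, \dim lx.2 = 1%N & (lx.2 <= lx.1)%VS]].

Definition over_lines (Sigma : set (linsp n)) : set (linsp n * linsp n) :=
  universal_line `&` fst @^-1` Sigma.

Definition tangent_vector (x w : 'rV[K]_n) : Prop :=
  \sum_i w 0 i * (f^`M(i)).@[x 0] = 0.

(* N_{l/X} is isomorphic to the direct sum of the O(a_k), X = V(f) smooth.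
   Let T_x be the kernel of df_x on K^n.  The fibre of N_{l/X} at [x] is
   Hom(<x>, T_x / l), i.e. N_{l/X} is the twist by O(1) of the bundle with
   fibres T_x / l, a subbundle of the trivial bundle K^n / l.  So a morphism
   O(a) -> N_{l/X}, that is a section of N_{l/X}(-a), is a homogeneous
   polynomial map s of degree 1 - a from l to K^n / l with s(x) in T_x / l; it
   lifts to K^n, and extends to a homogeneous polynomial map on K^n.  Such maps
   s_k define an isomorphism from the sum of the O(a_k) iff for every x <> 0
   in l the s_k(x) induce a basis of T_x / l. *)
Definition normal_bundle_splits r (a : r.-tuple int) (l : linsp n) : Prop :=
  exists s : 'I_r -> 'I_n -> {mpoly K[n]},
    (forall k i, exists2 d : nat, d%:Z = 1 - tnth a k & s k i \is d.-homog) /\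
    forall x : 'rV[K]_n, x \in l -> x != 0 ->
      let sx := [seq poly_map (s k) x | k <- enum 'I_r] in
      [/\ free sx, (l :&: <<sx>> = 0)%VS &
          forall w : 'rV[K]_n, w \in (l + <<sx>>)%VS <-> tangent_vector x w].

Definition second_type : set (linsp n) :=
  [set l | fano l /\ normal_bundle_splits [tuple -1; 1; 1] l].

Definition second_type_locus : set (linsp n) :=
  snd @` over_lines second_type.

(* Lines in V(f) joining a point of Y to a point of Z. *)
Definition ruling (Y Z : set (linsp n)) : set (linsp n) :=
  fano `&` [set l | exists y z, [/\ Y y, Z z & l = (y + z)%VS]].

End Hypersurface.

(* For a set T of pairs (line, point), the projection p = snd : T -> p(T) has
   degree one, i.e. is birational: over a dense open subset of p(T) its fibre
   is one point, depending algebraically on the base point (the line is spanned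
   by two vectors with polynomial coordinates). *)
Definition generically_degree_one n (T : set (linsp n * linsp n)) : Prop :=
  exists (B : set (linsp n)) (s1 s2 : 'I_n -> {mpoly K[n]}),
    [/\ proj_closed B,
        proj_dense_in (snd @` T `\` B) (snd @` T) &
        forall v : 'rV[K]_n, (snd @` T `\` B) <[v]>%VS ->
          T `&` snd @^-1` [set <[v]>%VS] =
          [set ((<[poly_map s1 v]> + <[poly_map s2 v]>)%VS, <[v]>%VS)]].

End ProjectiveGeometry.

Section Fermat.
Variable K : closedFieldType.

Definition cubes (A : {set 'I_6}) : {mpoly K[6]} := \sum_(i in A) 'X_i ^+ 3.

Definition fermat : {mpoly K[6]} := \sum_i 'X_i ^+ 3.

Definition coord_zeros (A : {set 'I_6}) : set (linsp K 6) :=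
  zeros [set 'X_i | i in [set i | i \in A]].

(* V_{i,j,k} and V_{i,j}, for A = {i,j,k} and A = {i,j}. *)
Definition VA (A : {set 'I_6}) : set (linsp K 6) :=
  hypersurface fermat `&` hypersurface (cubes A).

(* For A = {i,j,k}: C_{i,j,k}, and C'_{i,j,k} = plane_cubic (~: A). *)
Definition plane_cubic (A : {set 'I_6}) : set (linsp K 6) :=
  VA A `&` coord_zeros (~: A).

(* S_{i,j,k}, for A = {i,j,k}. *)
Definition S3 (A : {set 'I_6}) : set (linsp K 6) :=
  ruling fermat (plane_cubic A) (plane_cubic (~: A)).

(* For A = {i,j}: the set of the p_{i,j}^(mu), and G_{i,j}. *)
Definition vertices (A : {set 'I_6}) : set (linsp K 6) :=
  hypersurface (cubes A) `&` coord_zeros (~: A).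

Definition cubic_surface (A : {set 'I_6}) : set (linsp K 6) :=
  hypersurface (cubes (~: A)) `&` coord_zeros A.

(* S_{i,j}^(mu), for A = {i,j} and pt = p_{i,j}^(mu). *)
Definition S2 (A : {set 'I_6}) (pt : linsp K 6) : set (linsp K 6) :=
  ruling fermat [set pt] (cubic_surface A).

End Fermat.

Arguments VA : clear implicits.
Arguments S3 : clear implicits.
Arguments vertices : clear implicits.

(* Main.v *)
Require Import Defs.
From HB Require Import structures.
From mathcomp Require Import all_boot all_order all_algebra.
From mathcomp Require Import mpoly complex.
From mathcomp Require Import classical_sets cardinality reals.
From mathcomp Require Import boolp.
From mathcomp Require Import ring zify.

(** The tangent space of the Fermat cubic at x is the orthogonal of the vector
    (x_i^2).  Along a line spanned by a and b these vectors span the space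
    generated by (a_i^2), (a_i b_i) and (b_i^2), so a 4-dimensional linear
    subspace is tangent along the line iff these three vectors are dependent,
    i.e. iff a nonzero binary quadratic form kills all the points (a_i, b_i).
    Such a form is a product of two linear forms; substituting a and b in them
    gives two vectors y and z of the line with y_i z_i = 0 for every i.  So the
    lines of second type are those spanned by two vectors with disjoint supports
    ([second_type_join]), and lying on the cubic then means that each of the two
    vectors satisfies its own Fermat equation.  Conversely, for such a line the
    tangent spaces form the pencil spanned by (y_i^2) and (z_i^2), and a splitting
    of the normal bundle can be written down ([join_second_type]).  A nonzero
    solution of a Fermat equation has at least two nonzero coordinates, so the
    supports are separated by a subset A of size 2 or 3, and the locus is the union
    of the loci of lines joining two Fermat varieties in the complementary
    coordinate subspaces of A and its complement.

    All that remains concerns such joins of Y, in the coordinate subspace of A,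
    and Z, in that of the complement.  The join is closed when Y and Z are: the
    Pluecker matrix of a line <y> + <z> has zero diagonal blocks, and the columns
    (rows) of its off-diagonal block are multiples of y (of z)
    ([join_grass_closed]).  It is irreducible when Y and Z are, by the usual
    argument for products ([join_irreducible]).  A point with nonzero components x_A
    and x_A' lies on the single line <x_A> + <x_A'>, which depends polynomially on
    it ([join_generically_degree_one]).  And a line <a> + <b> with all coordinates
    of a on A and of b off A nonzero remembers A up to complement, because A
    can be read off the vanishing Pluecker coordinates ([generic_join_parts]); this
    separates the components.

    The one serious algebraic input is the irreducibility of the Fermat varieties
    in three or four variables ([cone_prime]).  Writing x_i = u - s, x_j = s and
    w for a third coordinate, the equation reads w^3 = u h with h prime to u:
    it is Eisenstein at u, so that no nonzero polynomial of degree at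
    most 2 in w has norm 0 ([eisenstein_cubic_norm]). *)

Set Implicit Arguments.
Unset Strict Implicit.
Unset Printing Implicit Defensive.

Import GRing.Theory.
Local Open Scope classical_set_scope.
Local Open Scope ring_scope.
Local Open Scope complex_scope.

(** * Eisenstein cubic extensions *)

Lemma factorX (D : idomainType) (p : {poly D}) : p.[0] = 0 -> exists q, p = q * 'X.
Proof.
move=> p0; have /factor_theorem[q ->] : root p 0 by apply/rootP.
by exists q; rewrite subr0.
Qed.

(** The norm of a + b w + c w^2 from the extension defined by w^3 = g. *)
Definition cubic_norm (A : comPzRingType) (g a b c : A) : A :=
  a ^+ 3 + b ^+ 3 * g + c ^+ 3 * g ^+ 2 - 3%:R * a * b * c * g.

(** The second factor is the product of the two conjugates of the first one. *)
Lemma cubic_norm_factor (A : comPzRingType) (w a b c : A) :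
  let g := w ^+ 3 in
  cubic_norm g a b c = (a + b * w + c * w ^+ 2) *
    (a ^+ 2 - b * c * g + (c ^+ 2 * g - a * b) * w + (b ^+ 2 - a * c) * w ^+ 2).
Proof. by rewrite /cubic_norm /=; ring. Qed.

Lemma rmorph_cubic_norm (A B : comPzRingType) (f : {rmorphism A -> B}) (g a b c : A) :
  f (cubic_norm g a b c) = cubic_norm (f g) (f a) (f b) (f c).
Proof.
by rewrite /cubic_norm rmorphB /= 2!rmorphD /= rmorphXn rmorphM rmorphXn rmorphM !rmorphXn 4!rmorphM rmorph_nat.
Qed.

Lemma size_mulX_nz (D : idomainType) (p : {poly D}) :
  size (p * 'X) = (size p + (p != 0%R))%N.
Proof.
have [->|p0] := eqVneq p 0; first by rewrite mul0r size_poly0.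
by rewrite size_mulX // addn1.
Qed.

(** Infinite descent at the prime 'X, which divides h * 'X exactly once: modulo 'X
    the equation successively forces 'X to divide a, b and c, and after division
    by 'X the three quotients satisfy the same equation. *)
Lemma eisenstein_cubic_norm (D : idomainType) (h a b c : {poly D}) :
  h.[0] != 0 -> cubic_norm (h * 'X) a b c = 0 -> [/\ a = 0, b = 0 & c = 0].
Proof.
move=> h0; move: {2}(_ + _)%N (leqnn (size a + size b + size c)) => n.
have root0 k (p q : {poly D}) : q.[0] != 0 -> (p ^+ 3 * q + k * 'X) * 'X = 0 ->
    exists p', p = p' * 'X.
  move=> q0 /eqP; rewrite mulf_eq0 polyX_eq0 orbF => /eqP/(congr1 (horner^~ 0)).
  rewrite hornerD hornerMX mulr0 addr0 hornerM horner_exp horner0 => /eqP.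
  rewrite mulf_eq0 (negPf q0) orbF.
  by rewrite expf_eq0 => /andP[_ /eqP/factorX].
elim: n a b c => [|n IHn] a b c.
  by rewrite leqn0 !addn_eq0 !size_poly_eq0 => /andP[/andP[/eqP-> /eqP->] /eqP->].
move=> szn N0.
have [a' Ea] : exists a', a = a' * 'X.
  apply: (@root0 (b ^+ 3 * h + c ^+ 3 * h ^+ 2 * 'X - 3%:R * a * b * c * h) a 1).
    by rewrite hornerC oner_eq0.
  by rewrite -[RHS](mul0r 'X) -N0 /cubic_norm; ring.
have {}N0 : (a' ^+ 3 * 'X ^+2 + b ^+ 3 * h + c ^+ 3 * h ^+ 2 * 'X
              - 3%:R * a' * b * c * h * 'X) * 'X = 0.
  by rewrite -[RHS]N0 /cubic_norm Ea; ring.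
have [b' Eb] : exists b', b = b' * 'X.
  apply: (@root0 (a' ^+ 3 * 'X + c ^+ 3 * h ^+ 2 - 3%:R * a' * b * c * h) b h) => //.
  by rewrite -[RHS]N0; ring.
have {}N0 : (a' ^+ 3 * 'X + b' ^+ 3 * h * 'X ^+ 2 + c ^+ 3 * h ^+ 2
              - 3%:R * a' * b' * c * h * 'X) * 'X = 0.
  have XX : ('X : {poly D}) != 0 by rewrite polyX_eq0.
  by apply: (mulIf XX); rewrite mul0r -[RHS]N0 Eb; ring.
have [c' Ec] : exists c', c = c' * 'X.
  apply: (@root0 (a' ^+ 3 + b' ^+ 3 * h * 'X - 3%:R * a' * b' * c * h) c (h ^+ 2)).
    by rewrite horner_exp expf_neq0.
  by rewrite -[RHS]N0; ring.
have {}N0 : cubic_norm (h * 'X) a' b' c' = 0.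
  have XX : ('X : {poly D}) != 0 by rewrite polyX_eq0.
  by apply: (mulIf XX); apply: (mulIf XX); rewrite !mul0r -[RHS]N0 Ec /cubic_norm; ring.
suff [a0 b0 c0] : [/\ a' = 0, b' = 0 & c' = 0].
  by rewrite Ea Eb Ec a0 b0 c0 !mul0r.
have [/and3P[/eqP-> /eqP-> /eqP->]//|nz] := boolP [&& a' == 0, b' == 0 & c' == 0].
apply: IHn (N0); move: szn nz; rewrite Ea Eb Ec !size_mulX_nz.
by do 3!case: eqP => _; rewrite ?addn0 ?addn1 ?addnS ?addSn //= ltnS => /ltnW //; do ?move/ltnW.
Qed.

(** A specialisation that keeps the leading coefficient of p nonzero maps p to a nonzero
    polynomial over K, which has only finitely many roots. *)
Lemma eval_separated_poly (K : closedFieldType) (D : idomainType) (T : Type)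
    (ev : T -> {rmorphism D -> K}) :
  (forall d, d != 0 -> exists t, ev t d != 0) ->
  forall p : {poly D}, p != 0 -> exists t u, (map_poly (ev t) p).[u] != 0.
Proof.
move=> sepD p p0; have [t lt0] := sepD (lead_coef p) ltac:(by rewrite lead_coef_eq0).
exists t; have /closed_nonrootP[u] : map_poly (ev t) p != 0; last by exists u.
by apply: contraNneq lt0 => /(congr1 (fun q : {poly K} => q`_(size p).-1)); rewrite coef_map coef0 /= => ->.
Qed.

Lemma closed_cbrt (K : closedFieldType) (c : K) : exists w, w ^+ 3 = c.
Proof.
have [w Ew] := @solve_monicpoly K 3 (fun i => if i is 0%N then c else 0) isT.
by exists w; rewrite Ew !big_ord_recl big_ord0 /= !mul0r !addr0 mulr1.
Qed.

(** * Irreducibility of the triple cover w^3 = u h *)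

Section TripleCover.
Variables (K : closedFieldType) (D : idomainType) (T : Type).
Variable ev : T -> {rmorphism D -> K}.
Hypothesis sepD : forall d, d != 0 -> exists t, ev t d != 0.

Definition eval1 t u (p : {poly D}) : K := (map_poly (ev t) p).[u].
Definition eval2 t u w (f : {poly {poly D}}) : K := (map_poly (eval1 t u) f).[w].

HB.instance Definition _ t u := GRing.RMorphism.copy (eval1 t u)
  (horner_eval u \o map_poly (ev t)).
HB.instance Definition _ t u w := GRing.RMorphism.copy (eval2 t u w)
  (horner_eval w \o map_poly (eval1 t u)).

(** If f g vanishes on the cover then the norms of f and g, which are polynomials
    on the base, have a product that vanishes at every point of the base, since
    every point of the base lifts to the cover.  So one of the norms is 0, and
    then f or g is divisible by w^3 - u h. *)
Lemma triple_cover_irreducible (h : {poly D}) (f g : {poly {poly D}}) :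
    h.[0] != 0 ->
    (forall t u w, w ^+ 3 = eval1 t u (h * 'X) ->
       eval2 t u w f * eval2 t u w g = 0) ->
  (forall t u w, w ^+ 3 = eval1 t u (h * 'X) -> eval2 t u w f = 0) \/
  (forall t u w, w ^+ 3 = eval1 t u (h * 'X) -> eval2 t u w g = 0).
Proof.
move=> h0 fg0; pose G := h * 'X.
(* remainder modulo w^3 - u h, of degree at most 2 in w *)
pose red (k : {poly {poly D}}) : {poly {poly D}} := Pdiv.Ring.rmodp k ('X^3 - G%:P).
pose N k := cubic_norm G (red k)`_0 (red k)`_1 (red k)`_2.
have mon : 'X^3 - G%:P \is monic by rewrite monicXnsubC.
have redE t u w k : w ^+ 3 = eval1 t u G -> eval2 t u w k =
    eval1 t u (red k)`_0 + eval1 t u (red k)`_1 * w + eval1 t u (red k)`_2 * w ^+ 2.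
  move=> Ew; rewrite {1}(Pdiv.RingMonic.rdivp_eq mon k) rmorphD rmorphM /=.
  have -> : eval2 t u w ('X^3 - G%:P) = 0.
    rewrite /eval2 rmorphB /= map_polyXn map_polyC /= !hornerE Ew subrr //.
  rewrite mulr0 add0r /eval2 -/(red k).
  have szr : (size (red k) <= 3)%N.
    rewrite -ltnS -(@size_XnsubC _ 3 G) //.
    by rewrite Pdiv.Ring.ltn_rmodpN0 // monic_neq0.
  rewrite (@horner_coef_wide _ 3); last by rewrite (leq_trans (size_poly _ _)).
  by rewrite !big_ord_recl big_ord0 /= !coef_map /= expr0 mulr1 expr1 addr0 addrA.
have NE t u w k : w ^+ 3 = eval1 t u G -> eval2 t u w k = 0 -> eval1 t u (N k) = 0.
  move=> Ew f0; rewrite /N rmorph_cubic_norm /= -Ew.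
  have := cubic_norm_factor w (eval1 t u (red k)`_0) (eval1 t u (red k)`_1)
    (eval1 t u (red k)`_2).
  by rewrite /= -(redE t u w k Ew) f0 mul0r.
have N0 k : N k = 0 -> forall t u w, w ^+ 3 = eval1 t u G -> eval2 t u w k = 0.
  move=> /(eisenstein_cubic_norm h0) [r0 r1 r2] t u w /redE ->.
  by rewrite r0 r1 r2 (rmorph0 (eval1 t u)) !mul0r !addr0.
have [/eqP|NN] := eqVneq (N f * N g) 0.
  by rewrite mulf_eq0 => /orP[]/eqP/N0; [left|right].
have [t [u]] := eval_separated_poly sepD NN.
have [w Ew] := closed_cbrt (eval1 t u G).
rewrite -/(eval1 t u _) rmorphM /= => /negP[]; apply/eqP.
have /eqP := fg0 t u w Ew; rewrite mulf_eq0 => /orP[]/eqP/(NE _ _ _ _ Ew)->.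
  by rewrite mul0r.
by rewrite mulr0.
Qed.
End TripleCover.

(** * Fermat cones are irreducible *)

(** Turns the values of P along a parametrised set into those of a single polynomial in
    the parameters. *)
Lemma rmorph_mmap_eval (K : comNzRingType) n (S : comNzRingType) (c : {rmorphism K -> S})
    (s : 'I_n -> S) (e : {rmorphism S -> K}) (P : {mpoly K[n]}) :
  (forall a, e (c a) = a) -> e (mmap c s P) = P.@[fun i => e (s i)].
Proof.
move=> ec; rewrite /meval /mmap rmorph_sum /=; apply: eq_bigr => m _.
rewrite rmorphM /= ec; congr (_ * _); rewrite /mmap1 rmorph_prod.
by apply: eq_bigr => i _; rewrite rmorphXn.
Qed.

Lemma meval_cubes (K : closedFieldType) (A : {set 'I_6}) v :
  (cubes K A).@[v] = \sum_(i in A) v i ^+ 3.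
Proof. by rewrite raddf_sum /=; apply: eq_bigr => i _; rewrite rmorphXn /= mevalXU. Qed.

Section FermatCone.
Variable K : closedFieldType.
Hypotheses (two0 : 2%:R != 0 :> K) (three0 : 3%:R != 0 :> K).

Definition fermat_cone (A : {set 'I_6}) (v : 'rV[K]_6) : Prop :=
  (forall i, i \notin A -> v 0 i = 0) /\ \sum_(i in A) v 0 i ^+ 3 = 0.

(* The base of the charts has the two parameters s and rho, besides u. *)
Let D := {poly {poly K}}.
Let ev (t : K * K) : {rmorphism D -> K} :=
  (horner_eval t.2 \o map_poly (horner_eval t.1) : {rmorphism _ -> _}).

Let ev_sep (d : D) : d != 0 -> exists t, ev t d != 0.
Proof.
move=> d0; have [|s [r nz]] := @eval_separated_poly K {poly K} K
   (fun t => horner_eval t : {rmorphism {poly K} -> K}) _ d d0; last by exists (s, r).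
by move=> p /closed_nonrootP[x]; exists x.
Qed.

(** On the open set x_i + x_j <> 0 of the cone over A, take u = x_i + x_j, s = x_j,
    w = x_k, and rho = x_l / u for the remaining index l of A, if there is one.
    Blowing up u = 0 in this way makes u divide x_i^3 + x_j^3 + x_l^3, with a
    quotient 3 s^2 at u = 0: the cubic equation for w becomes Eisenstein at u. *)
Section Chart.
Variables (A : {set 'I_6}) (i j k : 'I_6).
Hypotheses (iA : i \in A) (jA : j \in A) (kA : k \in A).
Hypotheses (ij : i != j) (ik : i != k) (jk : j != k) (cardA : (#|A| <= 4)%N).

Let B := A :\ i :\ j :\ k.

Let sum_split (F : 'I_6 -> K) : \sum_(l in A) F l = F i + F j + F k + \sum_(l in B) F l.
Proof.
rewrite (big_setD1 i) //= (big_setD1 j) ?inE 1?eq_sym ?ij //=.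
by rewrite (big_setD1 k) ?inE 1?eq_sym ?jk 1?eq_sym ?ik //= !addrA.
Qed.

Let card_B : (#|B| <= 1)%N.
Proof.
move: cardA; rewrite (cardsD1 i A) iA (cardsD1 j (A :\ i)) !inE eq_sym ij jA /=.
by rewrite (cardsD1 k (A :\ i :\ j)) !inE (eq_sym k) jk (eq_sym k) ik kA.
Qed.

Let s : D := 'X%:P.
Let rho : D := 'X.
(* h * 'X = - (x_i^3 + x_j^3 + the cube of the remaining coordinate) *)
Let h : {poly D} := - ((1 + #|B|%:R * rho ^+ 3)%:P * 'X * 'X - (3%:R * s)%:P * 'X
  + (3%:R * s ^+ 2)%:P).

Let chart (l : 'I_6) : {poly {poly D}} :=
  if l == i then ('X - s%:P)%:P else if l == j then s%:P%:P
  else if l == k then 'X else if l \in B then (rho%:P * 'X)%:P else 0.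


Let ev_s t : ev t s = t.1.
Proof.
transitivity (map_poly (horner_eval t.1) s).[t.2]; first by [].
by rewrite /s map_polyC hornerC /= /horner_eval hornerX.
Qed.

Let ev_rho t : ev t rho = t.2.
Proof.
transitivity (map_poly (horner_eval t.1) rho).[t.2]; first by [].
by rewrite /rho map_polyX hornerX.
Qed.

Let eval1_C t u d : eval1 ev t u d%:P = ev t d.
Proof. by rewrite /eval1 map_polyC hornerC. Qed.

Let eval1_X t u : eval1 ev t u 'X = u.
Proof. by rewrite /eval1 map_polyX hornerX. Qed.

Let eval2_C t u w p : eval2 ev t u w p%:P = eval1 ev t u p.
Proof. by rewrite /eval2 map_polyC /= hornerC. Qed.

Let chartE t u w l : eval2 ev t u w (chart l) =
  if l == i then u - t.1 else if l == j then t.1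
  else if l == k then w else if l \in B then t.2 * u else 0.
Proof.
rewrite /chart; case: eqP => _.
  by rewrite eval2_C rmorphB /= eval1_X eval1_C ev_s.
case: eqP => _; first by rewrite eval2_C eval1_C ev_s.
case: eqP => _; first by rewrite /eval2 map_polyX hornerX.
case: ifP => _; last by rewrite rmorph0.
by rewrite eval2_C rmorphM /= eval1_X eval1_C ev_rho.
Qed.

Let h0 : h.[0] != 0.
Proof.
rewrite /h hornerN 2!hornerD hornerN !hornerMX !mulr0 subr0 add0r hornerC.
rewrite oppr_eq0 mulf_neq0 ?expf_neq0 ?polyC_eq0 ?polyX_eq0 //.
by rewrite -!polyC_natr !polyC_eq0.
Qed.

Let eval1_hX t u : eval1 ev t u (h * 'X) =
  - ((u - t.1) ^+ 3 + t.1 ^+ 3 + #|B|%:R * (t.2 * u) ^+ 3).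
Proof.
rewrite rmorphM /= /h rmorphN rmorphD rmorphB !(rmorphM (eval1 ev t u)) /= !eval1_C eval1_X.
have -> : ev t (1 + #|B|%:R * rho ^+ 3) = 1 + #|B|%:R * t.2 ^+ 3.
  by rewrite rmorphD rmorph1 rmorphM rmorph_nat rmorphXn ev_rho.
have -> : ev t (3%:R * s) = 3%:R * t.1 by rewrite rmorphM rmorph_nat ev_s.
have -> : ev t (3%:R * s ^+ 2) = 3%:R * t.1 ^+ 2.
  by rewrite rmorphM rmorph_nat rmorphXn ev_s.
ring.
Qed.

Lemma cone_prime_chart (P Q : {mpoly K[6]}) :
    (forall v, fermat_cone A v -> v 0 i + v 0 j != 0 -> P.@[v 0] * Q.@[v 0] = 0) ->
  (forall v, fermat_cone A v -> v 0 i + v 0 j != 0 -> P.@[v 0] = 0) \/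
  (forall v, fermat_cone A v -> v 0 i + v 0 j != 0 -> Q.@[v 0] = 0).
Proof.
move=> PQ0.
pose c : {rmorphism K -> {poly {poly D}}} :=
  (polyC \o (polyC \o (polyC \o polyC)) : {rmorphism _ -> _}).
pose pull P : {poly {poly D}} := mmap c chart P.
pose vec t u w : 'rV[K]_6 := \row_l eval2 ev t u w (chart l).
have ec t u w a : eval2 ev t u w (c a) = a.
  rewrite /c /= eval2_C /eval1 map_polyC hornerC /=.
  transitivity ((map_poly (horner_eval t.1) a%:P%:P).[t.2]); first by [].
  by rewrite map_polyC hornerC /= /horner_eval hornerC.
have pullE t u w R : eval2 ev t u w (pull R) = R.@[vec t u w 0].
  have Ev := @rmorph_mmap_eval K 6 _ c chart (eval2 ev t u w) R (ec t u w).
  by rewrite /pull Ev; apply: meval_eq => l; rewrite mxE.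
have vec_ij t u w : vec t u w 0 i + vec t u w 0 j = u.
  by rewrite !mxE !chartE !eqxx eq_sym (negPf ij) subrK.
have vec_off t u w l : l \notin A -> vec t u w 0 l = 0.
  move=> lA; rewrite mxE chartE !inE (negPf lA) !andbF.
  by do 3!(case: eqP => [El|_]; first by rewrite El ?iA ?jA ?kA in lA).
have vec_sum t u w : \sum_(l in A) vec t u w 0 l ^+ 3 =
    w ^+ 3 - eval1 ev t u (h * 'X).
  rewrite sum_split !mxE !chartE !eqxx (eq_sym j i) (negPf ij) (eq_sym k i) (negPf ik).
  rewrite (eq_sym k j) (negPf jk).
  rewrite (eq_bigr (fun=> (t.2 * u) ^+ 3)) => [|l lB].
    by rewrite sumr_const eval1_hX -mulr_natl; ring.
  rewrite mxE chartE lB; move: lB; rewrite !inE => /and4P[/negPf-> /negPf-> /negPf->] //.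
have vec_cone t u w : w ^+ 3 = eval1 ev t u (h * 'X) -> fermat_cone A (vec t u w).
  by move=> Ew; split=> [l /vec_off->//|]; rewrite vec_sum Ew subrr.
(* the sum over B is the remaining coordinate, or 0 if there is none *)
have vec_onto v : fermat_cone A v -> v 0 i + v 0 j != 0 ->
    exists t w, w ^+ 3 = eval1 ev t (v 0 i + v 0 j) (h * 'X) /\
      vec t (v 0 i + v 0 j) w = v.
  move=> [v_off v_sum] u0; set u := v 0 i + v 0 j in u0 *.
  exists (v 0 j, (\sum_(l in B) v 0 l) / u), (v 0 k).
  set t := (_, _); suff Ev : vec t u (v 0 k) = v.
    by split=> //; apply/eqP; rewrite -subr_eq0 -vec_sum Ev v_sum.
  apply/rowP => l; rewrite mxE chartE /=.
  case: eqP => [->|/eqP li]; first by rewrite addrK.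
  case: eqP => [->//|/eqP lj]; case: eqP => [->//|/eqP lk].
  case: ifPn => lB; last by rewrite v_off //; move: lB; rewrite !inE li lj lk.
  have /cards1P[x Bx] : #|B| == 1%N.
    by rewrite eqn_leq card_B card_gt0; apply/set0Pn; exists l.
  by move: lB; rewrite Bx inE => /eqP->; rewrite big_set1 divfK.
(* multiplying by u reduces the vanishing to the open set u <> 0 *)
pose X : {poly {poly D}} := 'X%:P.
have EX t u w : eval2 ev t u w X = u by rewrite eval2_C eval1_X.
have [t u w Ew|fP0|gQ0] := triple_cover_irreducible ev_sep (f := pull P * X)
    (g := pull Q * X) h0.
- rewrite !rmorphM /= !pullE EX mulrACA.
  have [->|u0] := eqVneq u 0; first by rewrite !mulr0.
  by rewrite PQ0 ?mul0r ?vec_ij //; apply: vec_cone.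
- left=> v /vec_onto + v0 => /(_ v0)[t [w [/fP0 + Ev]]].
  by rewrite rmorphM /= EX pullE Ev => /eqP; rewrite mulf_eq0 (negPf v0) orbF => /eqP.
right=> v /vec_onto + v0 => /(_ v0)[t [w [/gQ0 + Ev]]].
by rewrite rmorphM /= EX pullE Ev => /eqP; rewrite mulf_eq0 (negPf v0) orbF => /eqP.
Qed.

End Chart.

(** Take all coordinates equal to 1 but one, equal to - t with t^3 = #|A| - 1. *)
Lemma generic_cone_point (A : {set 'I_6}) : (3 <= #|A| <= 4)%N ->
  exists v, [/\ fermat_cone A v, (forall i, i \in A -> v 0 i != 0) &
    forall i j, i \in A -> j \in A -> i != j -> v 0 i + v 0 j != 0].
Proof.
move=> cardA; have /card_gt0P[k kA] : (0 < #|A|)%N by case: #|A| cardA.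
have [t Et] := closed_cbrt (#|A|.-1%:R : K).
have t0 : t != 0.
  apply: contraNneq three0 => t0; move: Et; rewrite t0 expr0n /=.
  by case/andP: cardA; case: #|A| => [|[|[|[|[|]]]]] //= _ _ /esym/eqP; rewrite ?(negPf two0).
have t1 : 1 - t != 0.
  rewrite subr_eq0; apply: contra_eq_neq Et => <-; rewrite expr1n.
  case/andP: cardA; case: #|A| => [|[|[|[|[|]]]]] //= _ _.
    by rewrite eq_sym -subr_eq0 -(@natrB _ _ 1) // oner_eq0.
  by rewrite eq_sym -subr_eq0 -(@natrB _ _ 1).
exists (\row_l if l == k then - t else if l \in A then 1 else 0); split.
- split=> [i iA|]; first by rewrite mxE (negPf iA) ifN //; apply: contraNneq iA => ->.
  rewrite (big_setD1 k) //= mxE eqxx (eq_bigr (fun=> 1)) => [|i].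
    rewrite sumr_const exprNn Et (cardsD1 k A) kA /= -signr_odd expr1.
    by rewrite mulN1r addNr.
  by rewrite !inE mxE => /andP[/negPf-> ->]; rewrite expr1n.
- by move=> i iA; rewrite mxE iA; case: ifP; rewrite ?oppr_eq0 ?oner_eq0.
move=> i j iA jA ij; rewrite !mxE iA jA.
have [Ei|_] := eqVneq i k; have [Ej|_] := eqVneq j k.
- by rewrite Ei Ej eqxx in ij.
- by rewrite addrC.
- by [].
exact: two0.
Qed.

(** The charts x_i + x_j <> 0 are irreducible and cover the cone without the origin
    (if all the sums vanish then x_i = - x_j = x_k = - x_i).  Any two of them meet at
    the generic point above, so that a polynomial which vanishes on one of them
    vanishes on all the others. *)
Lemma cone_prime (A : {set 'I_6}) (P Q : {mpoly K[6]}) : (3 <= #|A| <= 4)%N ->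
    (forall v, fermat_cone A v -> v != 0 -> P.@[v 0] * Q.@[v 0] = 0) ->
  (forall v, fermat_cone A v -> v != 0 -> P.@[v 0] = 0) \/
  (forall v, fermat_cone A v -> v != 0 -> Q.@[v 0] = 0).
Proof.
move=> cardA; have [e [eA _ e0]] := generic_cone_point cardA.
have /andP[_ card4] := cardA.
have pick_out (s : seq 'I_6) : (size s < #|A|)%N -> exists2 k, k \in A & k \notin s.
  move=> ltsA; suff /subsetPn[k] : ~~ (A \subset [set x in s]) by rewrite inE; exists k.
  apply: contraL ltsA => /subset_leq_card; rewrite -leqNgt => /leq_trans; apply.
  by rewrite cardsE card_size.
have third i j : exists2 k, k \in A & (i != k) && (j != k).
  have [|k kA] := pick_out [:: i; j]; first by case/andP: cardA.
  by rewrite !inE negb_or eq_sym (eq_sym k); exists k.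
have chart i j := @cone_prime_chart A i j.
have nz (v : 'rV[K]_6) i j : v 0 i + v 0 j != 0 -> v != 0.
  by apply: contraNneq => ->; rewrite !mxE addr0.
(* P' * (X_i + X_j) vanishes on the chart of a and b *)
have spread P' i j : i \in A -> j \in A -> i != j ->
    (forall v, fermat_cone A v -> v 0 i + v 0 j != 0 -> P'.@[v 0] = 0) ->
  forall v, fermat_cone A v -> v != 0 -> P'.@[v 0] = 0.
  move=> iA jA ij P0 v vA v0.
  have [a [b [aA bA ab ab0]]] : exists a b, [/\ a \in A, b \in A, a != b & v 0 a + v 0 b != 0].
    have [/existsP[a /existsP[b /and4P[? ? ? ?]]]|] :=
      boolP [exists a, exists b, [&& a \in A, b \in A, a != b & v 0 a + v 0 b != 0]].
      by exists a, b.
    rewrite negb_exists => /forallP all0; case/negP: v0; apply/eqP/rowP => x; rewrite !mxE.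
    have opp a b : a \in A -> b \in A -> a != b -> v 0 a = - v 0 b.
      move=> aA bA ab; have := all0 a; rewrite negb_exists => /forallP/(_ b).
      by rewrite aA bA ab /= negbK addr_eq0 => /eqP.
    have [xA|/(proj1 vA)//] := boolP (x \in A).
    have [y yA] := pick_out [:: x] (leq_trans (isT : 1 < 3)%N (proj1 (andP cardA))).
    rewrite inE eq_sym => xy; have [z zA /andP[xz yz]] := third x y.
    have /eqP : v 0 x = - v 0 x.
      by rewrite {1}(opp x y) // (opp y z) // (opp z x) 1?eq_sym // opprK.
    by rewrite -addr_eq0 -mulr2n -mulr_natl mulf_eq0 (negPf two0) => /eqP.
  have [k kA /andP[ak bk]] := third a b.
  have [w wA w0|->//|] := chart a b k aA bA kA ab ak bk card4 P' ('X_i + 'X_j).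
    rewrite mevalD !mevalXU; have [->|ij0] := eqVneq (w 0 i + w 0 j) 0.
      by rewrite mulr0.
    by rewrite P0 // mul0r.
  move=> /(_ e eA (e0 _ _ aA bA ab)); rewrite mevalD !mevalXU => /eqP.
  by rewrite (negPf (e0 _ _ iA jA ij)).
move=> PQ0; have [i iA _] := pick_out [::] (leq_trans (isT : 0 < 3)%N (proj1 (andP cardA))).
have [j jA] := pick_out [:: i] (leq_trans (isT : 1 < 3)%N (proj1 (andP cardA))).
rewrite inE eq_sym => ij; have [k kA /andP[ik jk]] := third i j.
have [w wA w0|P0|Q0] := chart i j k iA jA kA ij ik jk card4 P Q.
- by rewrite PQ0 //; apply: nz w0.
- by left; apply: spread P0.
by right; apply: spread Q0.
Qed.

End FermatCone.

(** * Lines spanned by two vectors *)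

Section Lines.
Variables (K : fieldType) (V : vectType K).
Implicit Types (u v w : V) (x l : {vspace V}).

Lemma dim1_line x : \dim x = 1%N -> exists2 v, v != 0 & x = <[v]>%VS.
Proof.
move=> dx; have x0 : x != 0%VS by rewrite -dimv_eq0 dx.
exists (vpick x); first by rewrite vpick0.
by apply/esym/eqP; rewrite eqEdim -memvE memv_pick dx dim_vline vpick0 x0.
Qed.

Lemma span2P u v w :
  reflect (exists a b, w = a *: u + b *: v) (w \in <[u]> + <[v]>)%VS.
Proof.
apply: (iffP memv_addP) => [[_ /vlineP[a ->] [_ /vlineP[b ->] ->]]|[a [b ->]]].
  by exists a, b.
by exists (a *: u); rewrite ?memvZ ?memv_line //; exists (b *: v); rewrite ?memvZ ?memv_line.
Qed.

Lemma dim_span2 u v : (\dim (<[u]> + <[v]>) == 2) = free [:: u; v].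
Proof. by rewrite /free span_cons span_seq1. Qed.

Lemma free2P u v :
  reflect (forall a b, a *: u + b *: v = 0 -> a = 0 /\ b = 0) (free [:: u; v]).
Proof.
have fP : reflect _ (free [:: u; v]) := @freeP _ _ 2 [tuple u; v].
apply: (iffP fP) => [H a b ab0|H k].
  have := H (fun i => if val i == 0%N then a else b).
  rewrite big_ord_recl big_ord1 /= => /(_ ab0) k0.
  by split; [exact: (k0 ord0)|exact: (k0 (lift ord0 ord0))].
rewrite big_ord_recl big_ord1 /= => /H[k0 k1] i.
case: i => [[|[|//]] lti]; [rewrite -[RHS]k0|rewrite -[RHS]k1]; congr k; exact: val_inj.
Qed.

Lemma dim2_line l : \dim l = 2%N ->
  exists u v, free [:: u; v] /\ l = (<[u]> + <[v]>)%VS.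
Proof.
move=> dl; have := vbasisP l; rewrite /basis_of.
case: (vbasis l) => s /= szs; move: szs; rewrite dl.
case: s => [|u [|v []]] //= _ /andP[/eqP sp fr]; exists u, v.
by rewrite fr -sp span_cons span_seq1.
Qed.

Lemma line_eq_span2 l u v : \dim l = 2%N -> u \in l -> v \in l -> free [:: u; v] ->
  l = (<[u]> + <[v]>)%VS.
Proof.
move=> dl ul vl; rewrite -dim_span2 => /eqP d2.
by apply/esym/eqP; rewrite eqEdim subv_add -!memvE ul vl d2 dl.
Qed.

End Lines.

(** * Vectors with complementary supports *)

Section Supports.
Variables (K : closedFieldType) (n : nat).
Implicit Types (A : {set 'I_n}) (a b u v : 'rV[K]_n) (l : linsp K n).

Definition supported A v : Prop := forall i, i \notin A -> v 0 i = 0.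

Definition part A v : 'rV[K]_n := \row_i (if i \in A then v 0 i else 0).

Lemma supportedZ A c v : supported A v -> supported A (c *: v).
Proof. by move=> vA i iA; rewrite mxE vA ?mulr0. Qed.

Lemma supported_neq0 A v : supported A v -> v != 0 -> exists2 i, i \in A & v 0 i != 0.
Proof.
move=> vA /rV0Pn[i vi]; exists i => //.
by apply: contraNT vi => /vA->.
Qed.

Lemma part_neq0 A v : part A v != 0 -> exists2 i, i \in A & v 0 i != 0.
Proof.
have pA : supported A (part A v) by move=> i iA; rewrite mxE (negPf iA).
by move=> /(supported_neq0 pA)[i iA]; rewrite mxE iA; exists i.
Qed.

Lemma supported_free A a b : supported A a -> supported (~: A) b -> a != 0 -> b != 0 ->
  free [:: a; b].
Proof.
move=> aA bA /(supported_neq0 aA)[i iA ai] /(supported_neq0 bA)[j jA bj].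
apply/free2P => c d /rowP E; split.
  move/eqP: (E i); rewrite !mxE (bA i) ?inE ?iA // mulr0 addr0 mulf_eq0 (negPf ai) orbF.
  by move/eqP.
move/eqP: (E j); rewrite !mxE (aA j) 1?mulr0 ?add0r ?mulf_eq0 ?(negPf bj) ?orbF.
  by move/eqP.
by move: jA; rewrite inE.
Qed.

Lemma part_comb A a b c d : supported A a -> supported (~: A) b ->
  part A (c *: a + d *: b) = c *: a /\ part (~: A) (c *: a + d *: b) = d *: b.
Proof.
move=> aA bA; split; apply/rowP => i; rewrite !mxE ?inE; case: ifPn => iA.
- by rewrite (bA i) ?inE ?iA // mulr0 addr0.
- by rewrite aA // mulr0.
- by rewrite aA // mulr0 add0r.
by rewrite bA ?mulr0 // inE.
Qed.

Definition lies_in A (Y : set (linsp K n)) : Prop :=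
  forall x, Y x -> \dim x = 1%N /\ forall v, v \in x -> supported A v.

Lemma lies_in_rep A Y x : lies_in A Y -> Y x ->
  exists2 a, a != 0 /\ supported A a & x = <[a]>%VS.
Proof.
move=> YA /YA[/dim1_line[a a0 ->] aA]; exists a => //.
by split=> //; apply: aA; apply: memv_line.
Qed.

Definition join (Y Z : set (linsp K n)) : set (linsp K n) :=
  [set l | exists y z, [/\ Y y, Z z & l = (y + z)%VS]].

Lemma join_rep A Y Z l : lies_in A Y -> lies_in (~: A) Z -> join Y Z l ->
  exists a b, [/\ a != 0, b != 0, supported A a, supported (~: A) b &
    [/\ Y <[a]>%VS, Z <[b]>%VS & l = (<[a]> + <[b]>)%VS]].
Proof.
move=> YA ZA [y [z [Yy Zz ->]]].
have [a [a0 aA] Ey] := lies_in_rep YA Yy; have [b [b0 bA] Ez] := lies_in_rep ZA Zz.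
by exists a, b; rewrite -Ey -Ez.
Qed.

Lemma join_dim A Y Z l : lies_in A Y -> lies_in (~: A) Z -> join Y Z l -> \dim l = 2%N.
Proof.
move=> YA ZA /(join_rep YA ZA)[a [b [a0 b0 aA bA [_ _ ->]]]].
by apply/eqP; rewrite dim_span2; apply: (supported_free aA bA).
Qed.

End Supports.

(** * Closed sets of points and of lines *)

Section Closed.
Variables (K : closedFieldType) (n : nat).
Implicit Types (v w a b : 'rV[K]_n) (I : set {mpoly K[n]}) (J : set {mpoly K[n * n]}).

Lemma zeros_line I v : v != 0 ->
  zeros I <[v]>%VS <-> forall P c, I P -> P.@[(c *: v) 0] = 0.
Proof.
move=> v0; split=> [[_ H] P c IP|H]; first by apply: H => //; rewrite memvZ ?memv_line.
by split=> [|P _ IP /vlineP[c ->]]; [rewrite dim_vline v0|exact: H].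
Qed.

Lemma restrict_line P (v w : 'rV[K]_n) :
  exists g : {poly K}, forall t, g.[t] = P.@[(v + t *: w) 0].
Proof.
pose s i := (v 0 i)%:P + (w 0 i)%:P * 'X : {poly K}.
exists (mmap polyC s P) => t.
have Eg := @rmorph_mmap_eval K n _ polyC s (horner_eval t) P (fun r => hornerC r t).
rewrite -[LHS]/(horner_eval t _) Eg; apply: meval_eq => i.
by rewrite /= /horner_eval !hornerE !mxE mulrC.
Qed.

(** Lets one always pick nonzero representatives: a polynomial that vanishes on a
    line minus the origin vanishes at the origin. *)
Lemma zeros_line_punctured I v : v != 0 ->
  zeros I <[v]>%VS <-> forall P c, I P -> c != 0 -> P.@[(c *: v) 0] = 0.
Proof.
move=> v0; apply: iff_trans (zeros_line I v0) _.
split=> [H P c IP _|H P c IP]; first exact: H.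
have [g gE] := restrict_line P 0 v.
rewrite -[c *: v]add0r -gE; suff -> : g = 0 by rewrite horner0.
apply/eqP; suff : g * 'X == 0 by rewrite mulf_eq0 polyX_eq0 orbF.
apply: contraT => /closed_nonrootP[t]; rewrite rootE hornerM hornerX gE add0r.
have [->|t0] := eqVneq t 0; first by rewrite mulr0 eqxx.
by rewrite H // mul0r eqxx.
Qed.

Definition proj_closure (Z : set (linsp K n)) : set (linsp K n) :=
  zeros [set P | forall x v, Z x -> v \in x -> P.@[v 0] = 0].

Lemma proj_closure_min (Z B : set (linsp K n)) :
  proj_closed B -> Z `<=` B -> proj_closure Z `<=` B.
Proof.
move=> [I ->] ZB x [dx clx]; split=> // P v IP; apply: clx => y w /ZB[_]; exact.
Qed.

Lemma sub_proj_closure (Z : set (linsp K n)) :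
  (forall x, Z x -> \dim x = 1%N) -> Z `<=` proj_closure Z.
Proof. by move=> dZ x Zx; split=> [|P v]; [exact: dZ|exact]. Qed.

Lemma pluecker_comb v w (a b c d : K) :
  pluecker (a *: v + b *: w) (c *: v + d *: w) = (a * d - b * c) *: pluecker v w.
Proof. by apply/matrixP => i j; rewrite !mxE; ring. Qed.

Definition grass_zeros J : set (linsp K n) :=
  [set l | \dim l = 2%N /\
    forall P (u v : 'rV[K]_n), J P -> u \in l -> v \in l ->
      P.@[mxvec (pluecker u v) 0] = 0].

Lemma grass_zeros_span2 J v w : free [:: v; w] ->
  grass_zeros J (<[v]> + <[w]>)%VS <->
  forall P c, J P -> P.@[mxvec (c *: pluecker v w) 0] = 0.
Proof.
move=> fr; split=> [[_ H] P c JP|H].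
  have := pluecker_comb v w c 0 0 1; rewrite mulr1 mul0r subr0 => <-.
  by apply: H => //; apply/span2P; [exists c, 0|exists 0, 1].
split=> [|P _ _ JP /span2P[a [b ->]] /span2P[c [d ->]]].
  by apply/eqP; rewrite dim_span2.
by rewrite pluecker_comb; apply: H.
Qed.

(** The Pluecker vector of a and b is linear in b. *)
Lemma grass_slice (C : set (linsp K n)) a : grass_closed C ->
  exists2 B, proj_closed B & forall b, free [:: a; b] ->
    (C (<[a]> + <[b]>)%VS <-> B <[b]>%VS).
Proof.
case=> J ->; pose col : (n * n).-tuple {mpoly K[n]} :=
  [tuple mxvec (\matrix_(i, j) (a 0 i *: 'X_j - a 0 j *: 'X_i)) 0 k | k < n * n].
have colE (P : {mpoly K[n * n]}) b : (P \mPo col).@[b 0] = P.@[mxvec (pluecker a b) 0].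
  rewrite comp_mpoly_meval; apply: meval_eq => k; rewrite tnth_mktuple.
  by case/mxvec_indexP: k => i j; rewrite !mxvecE !mxE mevalB !mevalZ !mevalXU.
have plZ b c : pluecker a (c *: b) = c *: pluecker a b.
  by apply/matrixP => i j; rewrite !mxE; ring.
exists (zeros [set P \mPo col | P in J]); first by eexists.
move=> b fr; have b0 : b != 0.
  apply: contraTneq fr => ->; apply/negP => /free2P/(_ 0 1)[].
    by rewrite scale0r scaler0 addr0.
  by move=> _ /eqP; rewrite oner_eq0.
apply: iff_trans (grass_zeros_span2 J fr) _; apply: iff_sym.
apply: iff_trans (zeros_line _ b0) _; split=> [H P c JP|H _ c [P JP <-]].
  by rewrite -plZ -colE; apply: H; exists P.
by rewrite colE plZ; apply: H.
Qed.

Lemma annihilate_minors (C : {set 'I_n}) v w :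
    (forall i j, i \in C -> j \in C -> pluecker v w i j = 0) ->
  exists2 ab : K * K, ab != 0 &
    forall i, i \in C -> (ab.1 *: v + ab.2 *: w) 0 i = 0.
Proof.
move=> M0; have [/exists_inP[i iC vi]|] := boolP [exists i in C, v 0 i != 0].
  exists (- w 0 i, v 0 i); first by rewrite xpair_eqE negb_and vi orbT.
  by move=> j jC; rewrite !mxE /=; have := M0 i j iC jC; rewrite !mxE => <-; ring.
rewrite negb_exists_in => /forall_inP v0; exists (1, 0).
  by rewrite xpair_eqE negb_and oner_eq0.
by move=> i iC; have /negPn/eqP vi := v0 i iC; rewrite !mxE /= vi mulr0 mul0r addr0.
Qed.

(** * Joins of sets in complementary coordinate subspaces *)

Section Join.
Variables (A : {set 'I_n}) (Y Z : set (linsp K n)).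
Hypotheses (YA : lies_in A Y) (ZA : lies_in (~: A) Z).

Lemma join_pluecker a b i j : supported A a -> supported (~: A) b ->
  i \in A -> j \notin A -> pluecker a b i j = a 0 i * b 0 j.
Proof. by move=> aA bA iA jA; rewrite !mxE (bA i) ?inE ?iA // mulr0 subr0. Qed.

Lemma join_pluecker0 a b i j : supported A a -> supported (~: A) b ->
  (i \in A) = (j \in A) -> pluecker a b i j = 0.
Proof.
move=> aA bA; rewrite !mxE; case: (boolP (i \in A)) => iA jA.
  by rewrite (bA j) ?(bA i) ?inE ?iA -?jA // !mulr0 subrr.
by rewrite (aA j) ?(aA i) -?jA // !mul0r subrr.
Qed.

(** The equations used are those that hold on the whole join.  Among them are the
    vanishing of the diagonal blocks of the Pluecker matrix, which provides
    vectors a supported on A and b supported off A spanning the line, and the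
    equations of Z (of Y) applied to the rows (columns) of the off-diagonal
    block a_i b_j, which are multiples of b (of a). *)
Lemma join_grass_closed : proj_closed Y -> proj_closed Z -> grass_closed (join Y Z).
Proof.
move=> [IY EY] [IZ EZ].
exists [set P | forall l u v, join Y Z l -> u \in l -> v \in l ->
                  P.@[mxvec (pluecker u v) 0] = 0].
apply/seteqP; split=> [l jl|l [dl H]].
  by split=> [|P u v JP ul vl]; [exact: (join_dim YA ZA jl)|exact: JP jl ul vl].
have {}H P u v : u \in l -> v \in l ->
    (forall a b c, a != 0 -> b != 0 -> supported A a -> supported (~: A) b ->
      Y <[a]>%VS -> Z <[b]>%VS -> P.@[mxvec (c *: pluecker a b) 0] = 0) ->
    P.@[mxvec (pluecker u v) 0] = 0.
  move=> ul vl HP; apply: H ul vl => m w x /(join_rep YA ZA)[a [b [a0 b0 aA bA]]].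
  move=> [Ya Zb ->] /span2P[p [q ->]] /span2P[r [s ->]].
  by rewrite pluecker_comb; apply: HP.
have minor0 u v i j : u \in l -> v \in l -> (i \in A) = (j \in A) -> pluecker u v i j = 0.
  move=> ul vl ij; rewrite -mxvecE -[LHS](mevalXU _ (mxvec_index i j)).
  apply: H => // a b c _ _ aA bA _ _; rewrite mevalXU mxvecE mxE.
  by rewrite join_pluecker0 ?mulr0.
have [u [v [fr El]]] := dim2_line dl.
have ul : u \in l by rewrite El; apply/span2P; exists 1, 0; rewrite scale1r scale0r addr0.
have vl : v \in l by rewrite El; apply/span2P; exists 0, 1; rewrite scale1r scale0r add0r.
have comb0 (ab : K * K) : ab != 0 -> ab.1 *: u + ab.2 *: v != 0.
  apply: contraNneq => /(free2P _ _ fr)[]; case: ab => /= ? ? -> ->; exact: eqxx.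
have combl (p q : K) : p *: u + q *: v \in l by rewrite El; apply/span2P; exists p, q.
have [pa /comb0 a0 a_off] := @annihilate_minors (~: A) u v
  (fun i j iA jA => minor0 u v i j ul vl ltac:(by move: iA jA; rewrite !inE => /negPf-> /negPf->)).
have [pb /comb0 b0 b_off] := @annihilate_minors A u v
  (fun i j iA jA => minor0 u v i j ul vl ltac:(by rewrite iA jA)).
move: a0 a_off b0 b_off (combl pa.1 pa.2) (combl pb.1 pb.2).
set a := _ + _; set b := _ + _; move: a b => a b a0 a_off b0 b_off al bl.
have aA : supported A a by move=> i iA; apply: a_off; rewrite inE.
have bA : supported (~: A) b by move=> i; rewrite inE negbK; apply: b_off.
exists <[a]>%VS, <[b]>%VS; split; last first.
- by apply: line_eq_span2 dl al bl (supported_free aA bA a0 b0).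
- have [i iA ai] := supported_neq0 aA a0; rewrite EZ; apply/zeros_line => // Q c IQ.
  have := H (Q \mPo [tuple (if j \in A then 0 else 'X_(mxvec_index i j)) | j < n])
    ((c / a 0 i) *: a) b (memvZ _ al) bl.
  rewrite comp_mpoly_meval => EQ; rewrite -[RHS]EQ.
    apply: meval_eq => j; rewrite tnth_mktuple; case: ifPn => jA.
      by rewrite meval0 mxE bA ?inE ?jA // mulr0.
    rewrite mevalXU mxvecE join_pluecker //; last exact: supportedZ.
    by rewrite !mxE divfK.
  move=> a' b' d a'0 b'0 a'A b'A _ Zb'; rewrite comp_mpoly_meval.
  move: Zb'; rewrite EZ => /(zeros_line _ b'0)/(_ _ (d * a' 0 i) IQ) EQ'.
  rewrite -[RHS]EQ'; apply: meval_eq => j; rewrite tnth_mktuple; case: ifPn => jA.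
    by rewrite meval0 mxE b'A ?inE ?jA // mulr0.
  by rewrite mevalXU mxvecE mxE join_pluecker // mxE mulrA.
have [j jA bj] := supported_neq0 bA b0; rewrite EY; apply/zeros_line => // Q c IQ.
rewrite inE in jA.
have := H (Q \mPo [tuple (if i \in A then 'X_(mxvec_index i j) else 0) | i < n])
  a ((c / b 0 j) *: b) al (memvZ _ bl).
rewrite comp_mpoly_meval => EQ; rewrite -[RHS]EQ.
  apply: meval_eq => i; rewrite tnth_mktuple; case: ifPn => iA; last first.
    by rewrite meval0 mxE aA // mulr0.
  rewrite mevalXU mxvecE join_pluecker //; last exact: supportedZ.
  by rewrite !mxE divfK // mulrC.
move=> a' b' d a'0 b'0 a'A b'A Ya' _; rewrite comp_mpoly_meval.
move: Ya'; rewrite EY => /(zeros_line _ a'0)/(_ _ (d * b' 0 j) IQ) EQ'.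
rewrite -[RHS]EQ'; apply: meval_eq => i; rewrite tnth_mktuple; case: ifPn => iA; last first.
  by rewrite meval0 mxE a'A // mulr0.
by rewrite mevalXU mxvecE mxE join_pluecker // mxE; ring.
Qed.

(** Irreducibility of a product.  If two closed sets C1 and C2 cover the join then,
    by irreducibility of Z, for every y one of them contains all the lines y + z;
    the set of the y for which a given one does is closed, because for fixed z the
    lines y + z in a closed set form a closed condition on y. *)
Lemma join_irreducible : irreducible (@proj_closed K n) Y -> irreducible (@proj_closed K n) Z ->
  irreducible (@grass_closed K n) (join Y Z).
Proof.
move=> [[y0 Yy0] irrY] [[z0 Zz0] irrZ].
split=> [|C1 C2 cC1 cC2 cov]; first by exists (y0 + z0)%VS; exists y0, z0.
have slice (C : set (linsp K n)) y : grass_closed C -> Y y -> exists2 B, proj_closed B &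
    forall z, Z z -> (C (y + z)%VS <-> B z).
  move=> cC /(lies_in_rep YA)[a [a0 aA] ->]; have [B cB HB] := grass_slice a cC.
  exists B => // z /(lies_in_rep ZA)[b [b0 bA] ->].
  by apply: HB; apply: supported_free bA a0 b0.
have slice' (C : set (linsp K n)) z : grass_closed C -> Z z -> exists2 B, proj_closed B &
    forall y, Y y -> (C (y + z)%VS <-> B y).
  move=> cC /(lies_in_rep ZA)[b [b0 bA] ->]; have [B cB HB] := grass_slice b cC.
  exists B => // y /(lies_in_rep YA)[a [a0 aA] ->]; rewrite addvC.
  apply: HB; have := supported_free aA bA a0 b0.
  by rewrite -!dim_span2 addvC.
pose YC C : set (linsp K n) := [set y | Y y /\ forall z, Z z -> C (y + z)%VS].
have cover : Y `<=` proj_closure (YC C1) `|` proj_closure (YC C2).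
  move=> y Yy; have [B1 cB1 HB1] := slice C1 y cC1 Yy.
  have [B2 cB2 HB2] := slice C2 y cC2 Yy.
  have [|ZB1|ZB2] := irrZ B1 B2 cB1 cB2.
  - by move=> z Zz; case: (cov (y + z)%VS); [exists y, z|move/HB1; left; auto|move/HB2; right; auto].
  - left; apply: sub_proj_closure => [x [/YA[]]//|]; split=> // z Zz.
    by apply/HB1 => //; apply: ZB1.
  - right; apply: sub_proj_closure => [x [/YA[]]//|]; split=> // z Zz.
    by apply/HB2 => //; apply: ZB2.
have fin C : grass_closed C -> Y `<=` proj_closure (YC C) -> join Y Z `<=` C.
  move=> cC YC1 l [y [z [Yy Zz ->]]]; have [B cB HB] := slice' C z cC Zz.
  apply/HB => //; apply: (proj_closure_min cB _ (YC1 y Yy)) => x [Yx Hx].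
  by apply/HB => //; apply: Hx.
have [] := irrY _ _ _ _ cover; try by eexists.
  by left; apply: fin.
by right; apply: fin.
Qed.

Lemma join_through l v : join Y Z l -> v \in l ->
  part A v != 0 -> part (~: A) v != 0 -> l = (<[part A v]> + <[part (~: A) v]>)%VS.
Proof.
move=> /(join_rep YA ZA)[a [b [a0 b0 aA bA [_ _ ->]]]] /span2P[c [d ->]].
have [-> ->] := part_comb c d aA bA.
have line k (x : 'rV[K]_n) : k *: x != 0 -> <[k *: x]>%VS = <[x]>%VS.
  move=> kx; apply/eqP; rewrite eqEdim -memvE memvZ ?memv_line //= !dim_vline kx.
  by rewrite leq_b1.
by move=> /line-> /line->.
Qed.

(** The exceptional set consists of the points of the two coordinate subspaces.
    Its complement is dense: a point of the line <a> + <b> is the limit at t = 0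
    of its translates by t (a + b), which are not exceptional for general t. *)
Lemma join_generically_degree_one (f : {mpoly K[n]}) : join Y Z `<=` fano f ->
  generically_degree_one (over_lines f (join Y Z)).
Proof.
move=> jf; pose I := [set P : {mpoly K[n]} | exists i j, [/\ i \in A, j \notin A & P = 'X_i * 'X_j]].
exists (zeros I), (fun i => if i \in A then 'X_i else 0), (fun i => if i \in A then 0 else 'X_i).
have offB v : v != 0 -> ~ zeros I <[v]>%VS -> part A v != 0 /\ part (~: A) v != 0.
  move=> v0 nB; split; apply/eqP => /rowP pv; apply: nB; apply/zeros_line => //.
    move=> _ c [i [j [iA jA ->]]]; rewrite mevalM !mevalXU !mxE.
    by have := pv i; rewrite !mxE iA => ->; rewrite mulr0 mul0r.
  move=> _ c [i [j [iA jA ->]]]; rewrite mevalM !mevalXU !mxE.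
  by have := pv j; rewrite !mxE !inE jA => ->; rewrite !mulr0.
split; first by exists I.
- split=> [x []//|B [IB ->] subB x [[l x']] [[/= fl dx xl] jl] <- {x}].
  have [v v0 Ex] := dim1_line dx; rewrite {}Ex -memvE in xl *.
  apply/zeros_line => // P c IP.
  have [a [b [a0 b0 aA bA [_ _ El]]]] := join_rep YA ZA jl.
  have /span2P[p [q Ev]] : v \in (<[a]> + <[b]>)%VS by rewrite -El.
  pose w t : 'rV[K]_n := (p + t) *: a + (q + t) *: b.
  have wv t : w t = v + t *: (a + b) by rewrite /w Ev !scalerDl scalerDr addrACA.
  (* g is P along the translates; it vanishes except perhaps at t = -p and t = -q *)
  have [g gE'] := restrict_line P (c *: v) (c *: (a + b)).
  have gE t : g.[t] = P.@[(c *: w t) 0] by rewrite gE'; apply: meval_eq => i; rewrite wv !mxE; ring.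
  have g0 : g * (('X + p%:P) * ('X + q%:P)) = 0.
    apply/eqP; apply: contraT => /closed_nonrootP[t]; rewrite rootE !(hornerM, hornerD, hornerX, hornerC) gE.
    have [pt|pt] := eqVneq (t + p) 0; first by rewrite pt mul0r mulr0 eqxx.
    have [qt|qt] := eqVneq (t + q) 0; first by rewrite qt !mulr0 eqxx.
    suff -> : P.@[(c *: w t) 0] = 0 by rewrite mul0r eqxx.
    have [pA pA'] := part_comb (p + t) (q + t) aA bA; rewrite -/(w t) in pA pA'.
    have pA0 : part A (w t) != 0 by rewrite pA scaler_eq0 negb_or addrC pt.
    have pA'0 : part (~: A) (w t) != 0 by rewrite pA' scaler_eq0 negb_or addrC qt.
    have w0 : w t != 0.
      by apply: contraNneq pA0 => ->; apply/eqP/rowP => i; rewrite !mxE if_same.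
    have /subB : (snd @` over_lines f (join Y Z) `\` zeros I) <[w t]>%VS.
      split.
        exists (l, <[w t]>%VS) => //; split=> //=; split=> //=.
          by rewrite dim_vline w0.
        by rewrite -memvE El; apply/span2P; exists (p + t), (q + t).
      move/(zeros_line _ w0) => IW.
      have [i iA wi] := part_neq0 pA0; have [j jA wj] := part_neq0 pA'0.
      rewrite inE in jA.
      have /eqP := IW ('X_i * 'X_j) 1 (ex_intro _ i (ex_intro _ j (And3 iA jA erefl))).
      by rewrite mevalM !mevalXU scale1r mulf_eq0 (negPf wi) (negPf wj).
    by move/(zeros_line _ w0)/(_ P c IP).
  have {}g0 : g = 0.
    move/eqP: g0; rewrite !mulf_eq0 -!size_poly_eq0 !size_XaddC !orbF size_poly_eq0.
    by move/eqP.
  by have := gE 0; rewrite g0 horner0 wv scale0r addr0 => ->.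
move=> v [[[l x]] [[/= fl dx xl] jl] /= Ex nB]; rewrite {}Ex in dx xl.
have v0 : v != 0 by move: dx; rewrite dim_vline; case: eqP.
have [pA pA'] := offB v v0 nB.
have s1E : poly_map (fun i => if i \in A then 'X_i else 0) v = part A v.
  by apply/rowP => i; rewrite !mxE; case: ifP => _; rewrite ?meval0 ?mevalXU.
have s2E : poly_map (fun i => if i \in A then 0 else 'X_i) v = part (~: A) v.
  by apply/rowP => i; rewrite !mxE inE; case: ifP => _; rewrite ?meval0 ?mevalXU.
rewrite s1E s2E; apply/seteqP; split=> [[l' x'] [[[/= _ _ vl'] jl'] /= Ex']|_ ->].
  by rewrite /= Ex' -memvE in vl' *; rewrite (join_through jl' vl').
by rewrite -memvE in xl; rewrite -(join_through jl xl) //; split=> //; split.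
Qed.

End Join.

(** The Pluecker coordinate a_i b_j is nonzero for i in A and j off A, while it
    vanishes when i and j are both in A' or both off A'.  So each part of the
    partition defined by A' lies in a part of the one defined by A. *)
Lemma generic_join_parts (A A' : {set 'I_n}) (a b : 'rV[K]_n) (Y Z : set (linsp K n)) i j :
    lies_in A' Y -> lies_in (~: A') Z -> supported A a -> supported (~: A) b ->
    (forall k, k \in A -> a 0 k != 0) -> (forall k, k \notin A -> b 0 k != 0) ->
    i \in A -> j \notin A ->
  join Y Z (<[a]> + <[b]>)%VS -> A' = A \/ A' = ~: A.
Proof.
move=> YA ZA aA bA a0 b0 iA jA /(join_rep YA ZA)[a' [b' [_ _ aA' bA' [_ _ El]]]].
have /span2P[p [q Ea]] : a \in (<[a']> + <[b']>)%VS.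
  by rewrite -El; apply/span2P; exists 1, 0; rewrite scale1r scale0r addr0.
have /span2P[r [s Eb]] : b \in (<[a']> + <[b']>)%VS.
  by rewrite -El; apply/span2P; exists 0, 1; rewrite scale1r scale0r add0r.
have same k m : (k \in A') = (m \in A') -> k \in A -> m \in A.
  move=> km kA; apply: contraT => mA; have := join_pluecker aA bA kA mA.
  rewrite {1}Ea {1}Eb pluecker_comb mxE (join_pluecker0 aA' bA' km) mulr0.
  by move/esym/eqP; rewrite mulf_eq0 (negPf (a0 k kA)) (negPf (b0 m mA)).
have ij : (i \in A') = ~~ (j \in A').
  have := contra (fun E => same i j (eqP E) iA) jA.
  by case: (i \in A'); case: (j \in A').
have [jA'|jA'] := boolP (j \in A'); rewrite jA' /= in ij; [right|left].
  apply/setP => k; rewrite inE; apply/idP/idP => [kA'|].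
    by apply: contra jA; apply: same; rewrite kA' jA'.
  by apply: contraR => kA'; apply: (same i k) => //; rewrite ij (negPf kA').
apply/setP => k; apply/idP/idP => [kA'|].
  by apply: (same i k) => //; rewrite ij kA'.
by apply: contraTT => kA'; apply: contra jA; apply: same; rewrite (negPf kA') (negPf jA').
Qed.

End Closed.

(** * Fermat varieties in coordinate subspaces *)

Section FermatLoci.
Variable K : closedFieldType.
Hypotheses (two0 : 2%:R != 0 :> K) (three0 : 3%:R != 0 :> K).
Implicit Types (A : {set 'I_6}) (v w y z : 'rV[K]_6).

Lemma meval_fermat v : (fermat K).@[v 0] = \sum_i v 0 i ^+ 3.
Proof. by rewrite raddf_sum /=; apply: eq_bigr => i _; rewrite rmorphXn /= mevalXU. Qed.

Lemma fermat_coneZ A c v : fermat_cone A v -> fermat_cone A (c *: v).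
Proof.
move=> [vA v0]; split=> [i iA|]; first by rewrite mxE vA ?mulr0.
under eq_bigr do rewrite mxE exprMn.
by rewrite -mulr_sumr v0 mulr0.
Qed.

Lemma sum_supported A v : supported A v -> \sum_(i in A) v 0 i ^+ 3 = \sum_i v 0 i ^+ 3.
Proof.
move=> vA; rewrite [RHS](bigID (mem A)) /= [X in _ + X]big1 ?addr0 // => i iA.
by rewrite vA ?expr0n.
Qed.

Lemma vertices_line A v : v != 0 -> vertices K A <[v]>%VS <-> fermat_cone A v.
Proof.
move=> v0; have hyp : hypersurface (cubes K A) <[v]>%VS <->
    forall c, \sum_(i in A) (c *: v) 0 i ^+ 3 = 0.
  apply: iff_trans (zeros_line _ v0) _; split=> [H c|H _ c ->].
    by rewrite -meval_cubes; apply: H.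
  by rewrite meval_cubes.
have coord : coord_zeros (~: A) <[v]>%VS <-> supported A v.
  apply: iff_trans (zeros_line _ v0) _; split=> [H i iA|H _ c [i /= iA <-]].
    have iA' : i \in ~: A by rewrite inE.
    by have := H 'X_i 1 (ex_intro2 _ _ i iA' erefl); rewrite mevalXU scale1r.
  by rewrite mevalXU mxE H ?mulr0 //; rewrite inE in iA.
split=> [[/hyp H /coord sv]|[sv H]].
  by split=> //; have := H 1; rewrite scale1r.
by split; [apply/hyp => c; have [] := fermat_coneZ c (conj sv H)|apply/coord].
Qed.

Lemma verticesP A p : vertices K A p <->
  exists v, [/\ v != 0, p = <[v]>%VS & fermat_cone A v].
Proof.
split=> [Vp|[v [v0 -> cv]]]; last exact/vertices_line.
have [[dp _] _] := Vp; have [v v0 Ep] := dim1_line dp.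
by exists v; split=> //; apply/vertices_line => //; rewrite -Ep.
Qed.

Lemma vertices_lies_in A : lies_in A (vertices K A).
Proof.
move=> _ /verticesP[v [v0 -> [vA _]]]; split; first by rewrite dim_vline v0.
by move=> _ /vlineP[c ->]; apply: supportedZ.
Qed.

Lemma vertices_closed A : proj_closed (vertices K A).
Proof.
exists ([set cubes K A] `|` [set 'X_i | i in [set i | i \in ~: A]]).
apply/seteqP; split=> x.
  by case=> [[dx H1] [_ H2]]; split=> // P v [/H1|/H2]; apply.
by case=> dx H; split; split=> // P v IP; apply: H; [left|right].
Qed.

Lemma cubic_surfaceE A : cubic_surface A = vertices K (~: A).
Proof. by rewrite /cubic_surface /vertices finset.setCK. Qed.

(** In this form the plane cubics, the cubic surfaces and the triples of points form
    a single family, indexed by subsets of size 3, 4 and 2. *)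
Lemma plane_cubicE A : plane_cubic A = vertices K A.
Proof.
rewrite /plane_cubic /VA; apply/seteqP; split=> x; first by case=> [[_ ?] ?].
move=> Vx; case: (Vx) => H1 H2; split=> //; split=> //.
have /verticesP[v [v0 -> cv]] := Vx; apply/zeros_line => // _ c ->.
by have [sv E] := fermat_coneZ c cv; rewrite meval_fermat -(sum_supported sv) E.
Qed.

Lemma vertices_irreducible A : (3 <= #|A| <= 4)%N ->
  irreducible (@proj_closed K 6) (vertices K A).
Proof.
move=> cardA; have [e [eA e0 _]] := generic_cone_point two0 three0 cardA.
have [k kA] : exists k, k \in A by apply/card_gt0P; case: #|A| cardA.
have en0 : e != 0 by apply: contraNneq (e0 k kA) => ->; rewrite mxE.
split=> [|B1 B2 [I1 ->] [I2 ->] cov]; first by exists <[e]>%VS; apply/vertices_line.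
have [[x [Vx nx]]|sub1] := pselect (exists x : linsp K 6, vertices K A x /\ ~ zeros I1 x); last first.
  by left=> x Vx; apply: contrapT => nx; apply: sub1; exists x.
right=> m Vm; apply: contrapT => nz.
have bad (I : set {mpoly K[6]}) p : vertices K A p -> ~ zeros I p ->
    exists P v, [/\ I P, fermat_cone A v, v != 0 & P.@[v 0] != 0].
  case/verticesP=> v [v0 -> cv] /(zeros_line_punctured I v0)/existsNP[P].
  move=> /existsNP[c /not_implyP[IP /not_implyP[c0 /eqP Pc]]].
  exists P, (c *: v); split=> //; first exact: fermat_coneZ.
  by rewrite scaler_eq0 negb_or c0.
have [P [v [IP cv v0 Pv]]] := bad I1 x Vx nx.
have [Q [w [IQ cw w0 Qw]]] := bad I2 m Vm nz.
have [u cu u0|P0|Q0] := @cone_prime K two0 three0 A P Q cardA.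
- have /cov[|] : vertices K A <[u]>%VS by apply/vertices_line.
    move/(zeros_line I1 u0)/(_ P 1 IP); rewrite scale1r => ->; exact: mul0r.
  move/(zeros_line I2 u0)/(_ Q 1 IQ); rewrite scale1r => ->; exact: mulr0.
- by rewrite P0 ?eqxx in Pv.
- by rewrite Q0 ?eqxx in Qw.
Qed.

Lemma sum_cubes_comb A a b (p q : K) : fermat_cone A a -> fermat_cone (~: A) b ->
  \sum_i (p *: a + q *: b) 0 i ^+ 3 = 0.
Proof.
move=> [aA a0] [bA b0].
rewrite (sum_supported aA) in a0; rewrite (sum_supported bA) in b0.
transitivity (p ^+ 3 * \sum_i a 0 i ^+ 3 + q ^+ 3 * \sum_i b 0 i ^+ 3); last first.
  by rewrite a0 b0 !mulr0 addr0.
rewrite !mulr_sumr -big_split /=.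
apply: eq_bigr => i _; rewrite !mxE; have [iA|iA] := boolP (i \in A).
  by rewrite (bA i) ?inE ?iA //; ring.
by rewrite aA //; ring.
Qed.

Lemma join_fano A Y Z : Y `<=` vertices K A -> Z `<=` vertices K (~: A) ->
  join Y Z `<=` fano (fermat K).
Proof.
move=> YA ZA l [_ [_ [/YA/verticesP[a [a0 -> ca]] /ZA/verticesP[b [b0 -> cb]] ->]]].
split; first by apply/eqP; rewrite dim_span2; apply: (supported_free ca.1 cb.1).
by move=> v /span2P[p [q ->]]; rewrite meval_fermat; apply: sum_cubes_comb ca cb.
Qed.

Lemma rulingE A Y Z : Y `<=` vertices K A -> Z `<=` vertices K (~: A) ->
  ruling (fermat K) Y Z = join Y Z.
Proof.
by move=> YA ZA; apply/seteqP; split=> [l []//|l jl]; split=> //; apply: (join_fano YA ZA).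
Qed.

Lemma S3E A : S3 K A = join (vertices K A) (vertices K (~: A)).
Proof. by rewrite /S3 !plane_cubicE (@rulingE A). Qed.

Lemma S2E A p : vertices K A p -> S2 A p = join [set p] (vertices K (~: A)).
Proof. by move=> Vp; rewrite /S2 cubic_surfaceE (@rulingE A) // => _ ->. Qed.

Lemma join_sym (Y Z : set (linsp K 6)) : join Y Z = join Z Y.
Proof.
by apply/seteqP; split=> l [y [z [Yy Zz ->]]]; exists z, y; rewrite addvC.
Qed.

Lemma fermat_cone_card A v : fermat_cone A v -> v != 0 -> (2 <= #|A|)%N.
Proof.
move=> [vA v0] vn0; rewrite ltnNge; apply/negP => cardA.
have [i iA vi] := supported_neq0 vA vn0.
have /cards1P[j Aj] : #|A| == 1%N.
  by rewrite eqn_leq cardA card_gt0; apply/finset.set0Pn; exists i.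
move: v0 iA; rewrite Aj big_set1 inE => /eqP; rewrite expf_eq0 => /andP[_ vj] /eqP ij.
by rewrite ij (eqP vj) eqxx in vi.
Qed.

(** Take for A the support of y.  It has at least 2 elements, and so has its
    complement, which contains the support of z; if A has 4 elements, exchange
    the roles of y and z. *)
Lemma disjoint_support_join l y z : fano (fermat K) l -> free [:: y; z] ->
    l = (<[y]> + <[z]>)%VS -> (forall i, y 0 i * z 0 i = 0) ->
  exists2 A : {set 'I_6}, #|A| = 3%N \/ #|A| = 2%N & join (vertices K A) (vertices K (~: A)) l.
Proof.
move=> [dl fl] fr El yz0.
have y0 : y != 0.
  apply: contraTneq fr => ->; apply/negP => /free2P/(_ 1 0)[].
    by rewrite scale0r scaler0 addr0.
  by move=> /eqP; rewrite oner_eq0.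
have z0 : z != 0.
  apply: contraTneq fr => ->; apply/negP => /free2P/(_ 0 1)[].
    by rewrite scale0r scaler0 addr0.
  by move=> _ /eqP; rewrite oner_eq0.
pose A := [set i | y 0 i != 0]%SET.
have yA : supported A y by move=> i; rewrite inE negbK => /eqP.
have zA : supported (~: A) z.
  move=> i; rewrite !inE negbK => yi; have /eqP := yz0 i.
  by rewrite mulf_eq0 (negPf yi) => /eqP.
have cy : fermat_cone A y.
  split=> //; rewrite sum_supported // -meval_fermat; apply: fl.
  by rewrite El; apply/span2P; exists 1, 0; rewrite scale1r scale0r addr0.
have cz : fermat_cone (~: A) z.
  split=> //; rewrite sum_supported // -meval_fermat; apply: fl.
  by rewrite El; apply/span2P; exists 0, 1; rewrite scale1r scale0r add0r.
have jl : join (vertices K A) (vertices K (~: A)) l.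
  by exists <[y]>%VS, <[z]>%VS; split=> //; apply/vertices_line.
have A2 : (2 <= #|A|)%N := fermat_cone_card cy y0.
have A'2 : (2 <= #|~: A|)%N := fermat_cone_card cz z0.
have cA : (#|A| + #|~: A| = 6)%N by rewrite finset.cardsC card_ord.
have split6 m k : (2 <= m -> 2 <= k -> m + k = 6 -> m <> 4 -> m = 3 \/ m = 2)%N.
  by clear; lia.
have [A4|/eqP A4] := eqVneq #|A| 4%N; last by exists A; first exact: split6 A2 A'2 cA A4.
exists (~: A); last by rewrite finset.setCK join_sym.
by right; move: cA; rewrite A4; apply: (@addnI 4 _ 2).
Qed.

End FermatLoci.

(** * Lines of second type *)

Lemma dhomog0_meval (K : closedFieldType) n (P : {mpoly K[n]}) (u v : 'I_n -> K) :
  P \is 0.-homog -> P.@[u] = P.@[v].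
Proof.
move=> /dhomogP P0; rewrite !mevalE; apply: eq_big_seq => m /P0 /eqP.
by rewrite mdeg_eq0 => /eqP->; congr (_ * _); apply: eq_bigr => i _; rewrite mnm0E.
Qed.

Section SecondType.
Variable K : closedFieldType.
Hypotheses (two0 : 2%:R != 0 :> K) (three0 : 3%:R != 0 :> K).
Implicit Types (A : {set 'I_6}) (v w y z : 'rV[K]_6).

Lemma mderiv_fermat i : (fermat K)^`M(i) = 3%:R *: 'X_i ^+ 2.
Proof.
rewrite /fermat linear_sum (bigD1 i) //= big1 => [|j ji].
  have Uii : (U_(i) - U_(i) = 0 :> 'X_{1..6})%MM.
    by apply/mnmP => k; rewrite mnmBE mnm0E subnn.
  rewrite exprS expr2 !mderivM !mderivX !mnm1E eqxx !scale1r Uii mpolyX0.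
  by rewrite scaler_nat; ring.
by rewrite exprS expr2 !mderivM !mderivX !mnm1E (negPf ji) !scale0r !(mulr0, mul0r, addr0).
Qed.

Lemma tangent_fermat v w :
  tangent_vector (fermat K) v w <-> \sum_i w 0 i * v 0 i ^+ 2 = 0.
Proof.
rewrite /tangent_vector.
have -> : \sum_i w 0 i * ((fermat K)^`M(i)).@[v 0] = 3%:R * \sum_i w 0 i * v 0 i ^+ 2.
  rewrite mulr_sumr; apply: eq_bigr => i _.
  by rewrite mderiv_fermat mevalZ rmorphXn /= mevalXU; ring.
split=> [/eqP|->]; last exact: mulr0.
by rewrite mulf_eq0 (negPf three0) => /eqP.
Qed.

Lemma quadratic_split (a b c : K) : (a, b, c) != 0 ->
  exists p q r s, [/\ (p, q) != 0, (r, s) != 0 &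
    forall X Y, a * X ^+ 2 + b * X * Y + c * Y ^+ 2 = (p * X + q * Y) * (r * X + s * Y)].
Proof.
move=> abc; have [a0|a0] := eqVneq a 0.
  exists 0, 1, b, c; split; first by rewrite xpair_eqE oner_eq0 andbF.
    by move: abc; rewrite a0 !xpair_eqE eqxx.
  by move=> X Y; rewrite a0; ring.
have [t Et] := @solve_monicpoly K 2 (fun i => if i is 0%N then - c / a else - b / a) isT.
exists 1, (- t), a, (b + a * t); split=> [||X Y].
- by rewrite xpair_eqE oner_eq0.
- by rewrite xpair_eqE (negPf a0).
have Ec : a * t ^+ 2 = - c - b * t.
  by rewrite Et !big_ord_recl big_ord0 /= expr0 expr1; field.
have -> : c = - (a * t ^+ 2) - b * t by rewrite Ec; ring.
ring.
Qed.

(** Orthogonality to m independent vectors bounds the rank of M by n - m. *)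
Lemma rank_le_free_rows m n k (N : 'M[K]_(m, n)) (M : 'M[K]_(k, n)) :
  row_free N -> N *m M^T = 0 -> (n < m + k)%N -> exists2 c : 'rV_k, c != 0 & c *m M = 0.
Proof.
move=> frN NM lt; have /rowV0Pn[c /sub_kermxP cM c0] : kermx M != 0; last by exists c.
rewrite kermx_eq0; apply: contraL lt => frM; rewrite -leqNgt.
have := mulmx0_rank_max NM; rewrite mxrank_tr.
by move/eqP: frN => ->; move/eqP: frM => ->.
Qed.

(** The two sections of degree 0 are constant vectors s1 and s2, and the space spanned
    by the line and by them is tangent at a, b and a + b; so it is orthogonal to
    (a_i^2), (b_i^2) and (a_i b_i).  Having dimension 4, it leaves them only a space
    of dimension 2. *)
Lemma second_type_join l : second_type (fermat K) l ->
  exists2 A : {set 'I_6}, #|A| = 3%N \/ #|A| = 2%N &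
    join (vertices K A) (vertices K (~: A)) l.
Proof.
case=> Fl [s [hs splits]]; have [dl fl] := Fl.
have [a [b [fr El]]] := dim2_line dl.
have al : a \in l by rewrite El; apply/span2P; exists 1, 0; rewrite scale1r scale0r addr0.
have bl : b \in l by rewrite El; apply/span2P; exists 0, 1; rewrite scale1r scale0r add0r.
have comb0 p q : (p, q) != 0 :> K * K -> p *: a + q *: b != 0.
  apply: contraNneq => /(free2P _ _ fr)[-> ->]; exact: eqxx.
have combl p q : p *: a + q *: b \in l by rewrite El; apply/span2P; exists p, q.
have a0 : a != 0.
  by have := comb0 1 0; rewrite scale1r scale0r addr0 xpair_eqE oner_eq0; apply.
have b0 : b != 0.
  by have := comb0 0 1; rewrite scale1r scale0r add0r xpair_eqE oner_eq0 andbF; apply.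
have ab0 : a + b != 0.
  by have := comb0 1 1; rewrite !scale1r xpair_eqE oner_eq0; apply.
pose k1 : 'I_3 := inord 1; pose k2 : 'I_3 := inord 2.
have const k x : k = k1 \/ k = k2 -> poly_map (s k) x = poly_map (s k) a.
  move=> Ek; apply/rowP => i; rewrite !mxE.
  have [d Ed hom] := hs k i; apply: dhomog0_meval.
  suff d0 : d = 0%N by rewrite d0 in hom.
  by case: Ek Ed => ->; rewrite (tnth_nth 0) inordK //= subrr => -[].
pose s1 := poly_map (s k1) a; pose s2 := poly_map (s k2) a.
have enum3 x : [seq poly_map (s k) x | k <- enum 'I_3] =
    [:: poly_map (s ord0) x; poly_map (s k1) x; poly_map (s k2) x].
  rewrite !enum_ordSl enum_ord0 /=; congr [:: _; poly_map (s _) x; poly_map (s _) x].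
    by apply: val_inj; rewrite /= inordK.
  by apply: val_inj; rewrite /= inordK.
have tang x w : x \in l -> x != 0 -> w \in [:: a; b; s1; s2] ->
    \sum_i w 0 i * x 0 i ^+ 2 = 0.
  move=> xl x0 wU; apply/tangent_fermat; have [_ _ H] := splits x xl x0; apply/H.
  rewrite enum3 (const k1 x) ?(const k2 x); [|by right|by left].
  move: wU; rewrite !inE => /or4P[]/eqP->.
  - by apply: subvP al; apply: addvSl.
  - by apply: subvP bl; apply: addvSl.
  - apply: (subvP (addvSr _ _)); apply: memv_span; by rewrite !inE eqxx orbT.
  - apply: (subvP (addvSr _ _)); apply: memv_span; by rewrite !inE eqxx !orbT.
have frU : free [:: a; b; s1; s2].
  have [frs cap0 _] := splits a al a0; move: frs cap0; rewrite enum3 => frs cap0.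
  have : free ([:: a; b] ++ [:: s1; s2]); last by [].
  rewrite cat_free fr /= ; apply/andP; split.
    by move: frs; rewrite free_cons => /andP[].
  apply/directv_addP; rewrite span_cons span_seq1 -El.
  apply/eqP; rewrite -subv0 -cap0; apply: capvS => //.
  by apply: sub_span => v; rewrite !inE => ->; rewrite orbT.
pose N : 'M[K]_(4, 6) := \matrix_i [:: a; b; s1; s2]`_i.
pose M : 'M[K]_(3, 6) := \matrix_(k, i)
  (if k == 0 :> nat then a 0 i ^+ 2 else if k == 1 :> nat then a 0 i * b 0 i else b 0 i ^+ 2).
have rowN i : row i N = [:: a; b; s1; s2]`_i by apply/rowP => j; rewrite !mxE.
have frN : row_free N.
  have frP : reflect _ (free [:: a; b; s1; s2]) := @freeP _ _ 4 [tuple a; b; s1; s2].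
  apply: inj_row_free => c cN; apply/rowP => i; rewrite mxE.
  apply: (frP frU (fun i => c 0 i)); rewrite -[RHS]cN mulmx_sum_row.
  by apply: eq_bigr => k _; rewrite rowN.
have NM : N *m M^T = 0.
  apply/matrixP => i k; rewrite !mxE.
  have wU : [:: a; b; s1; s2]`_i \in [:: a; b; s1; s2] by apply: mem_nth.
  have Ta := tang a _ al a0 wU; have Tb := tang b _ bl b0 wU.
  have Tab := tang _ _ (memvD al bl) ab0 wU.
  move: {wU} Ta Tb Tab; set w := _`_i => Ta Tb Tab.
  under eq_bigr => j _ do rewrite !mxE.
  case: k => [[|[|[|//]]] ltk] //=.
  apply/eqP; rewrite -[_ == 0]orFb -(negPf two0) -mulf_eq0; apply/eqP.
  transitivity (\sum_i w 0 i * (a + b) 0 i ^+ 2 - \sum_i w 0 i * a 0 i ^+ 2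
                - \sum_i w 0 i * b 0 i ^+ 2); last by rewrite Ta Tb Tab !subr0.
  rewrite mulr_sumr -!sumrB; apply: eq_bigr => j _; rewrite !mxE; ring.
have [c c0 cM] := rank_le_free_rows frN NM isT.
have /quadratic_split[p [q [r [t [pq rt split]]]]] :
    (c 0 0, c 0 k1, c 0 k2) != 0 :> K * K * K.
  apply: contraNneq c0 => -[c00 c01 c02]; apply/eqP/rowP => k; rewrite mxE.
  case: k => [[|[|[|//]]] ltk]; [rewrite -[RHS]c00|rewrite -[RHS]c01|rewrite -[RHS]c02];
    by congr (c 0 _); apply: val_inj; rewrite /= ?inordK.
have yz0 i : (p *: a + q *: b) 0 i * (r *: a + t *: b) 0 i = 0.
  rewrite !mxE -split; move/rowP/(_ i): cM; rewrite !mxE !big_ord_recl big_ord0 /= => <-.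
  rewrite !mxE /= addr0 addrA; congr (_ + _ + _); rewrite -?mulrA; congr (c 0 _ * _);
    by apply: val_inj; rewrite /= inordK.
have {pq} := comb0 p q pq; have {rt} := comb0 r t rt.
have := combl p q; have := combl r t; move: yz0.
set y := p *: a + _; set z := r *: a + _; move: y z => y z yz0 zl yl z0 y0.
have yz_free : free [:: y; z].
  have nz (u v : 'rV[K]_6) f g : (forall i, u 0 i * v 0 i = 0) -> u != 0 ->
      f *: u + g *: v = 0 -> f = 0.
    move=> uv0 /rV0Pn[i ui] /rowP/(_ i); rewrite !mxE => E; apply/eqP.
    have /eqP : f * u 0 i ^+ 2 = 0.
      transitivity (u 0 i * (f * u 0 i + g * v 0 i) - g * (u 0 i * v 0 i)); first by ring.
      by rewrite E uv0 !mulr0 subr0.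
    by rewrite mulf_eq0 expf_eq0 (negPf ui) orbF.
  apply/free2P => f g E; split; first exact: nz yz0 y0 E.
  by apply: (nz z y g f) => // [i|]; rewrite 1?mulrC // addrC.
exact: (disjoint_support_join Fl yz_free (line_eq_span2 dl yl zl yz_free) yz0).
Qed.

Definition mulmx_ker m (Q : 'M[K]_(6, m)) : linsp K 6 :=
  lker (linfun (mulmxr Q : 'rV[K]_6 -> 'rV[K]_m)).

Lemma mem_mulmx_ker m (Q : 'M[K]_(6, m)) w : (w \in mulmx_ker Q) = (w *m Q == 0).
Proof. by rewrite memv_ker lfunE. Qed.

Lemma dim_rV m : \dim (fullv : {vspace 'rV[K]_m}) = m.
Proof. by rewrite dimvf dim_matrix mul1r. Qed.

Lemma dim_mulmx_ker m (Q : 'M[K]_(6, m)) : (6 <= \dim (mulmx_ker Q) + m)%N.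
Proof.
have := limg_ker_dim (linfun (mulmxr Q : 'rV[K]_6 -> 'rV[K]_m)) fullv.
rewrite capfv dim_rV => E; rewrite -{1}E leq_add2l.
by rewrite (leq_trans (dimvS (subvf _))) // dim_rV.
Qed.

(** The orthogonal U of (a_k^2) and (b_k^2) has dimension 4, contains the line and is
    tangent along it.  The constant sections are a basis of a complement of the line
    in U.  For indices i in the support of a and j in that of b, the quadratic section
    x_j^2 e_i - x_i^2 e_j is tangent at x and never lies in U for x <> 0 on the line. *)
Lemma join_second_type A l : join (vertices K A) (vertices K (~: A)) l ->
  second_type (fermat K) l.
Proof.
move=> jl; split; first exact: (join_fano (fun _ => id) (fun _ => id) jl).
have [a [b [a0 b0 aA bA [/(vertices_line _ a0)[_ ca] /(vertices_line _ b0)[_ cb] El]]]] :=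
  join_rep (@vertices_lies_in K A) (@vertices_lies_in K (~: A)) jl.
have [i iA ai] := supported_neq0 aA a0; have [j] := supported_neq0 bA b0.
rewrite inE => jA bj.
have ab k : a 0 k * b 0 k = 0.
  have [kA|kA] := boolP (k \in A); last by rewrite aA // mul0r.
  by rewrite bA ?mulr0 // inE kA.
have aj : a 0 j = 0 by apply: aA.
have bi : b 0 i = 0 by apply: bA; rewrite inE iA.
pose e k : 'rV[K]_6 := delta_mx 0 k.
have sum_e k (F : 'I_6 -> K) : \sum_m e k 0 m * F m = F k.
  rewrite (bigD1 k) //= big1 => [|m mk]; first by rewrite !mxE !eqxx mul1r addr0.
  by rewrite !mxE (negPf mk) mul0r.
pose Q : 'M[K]_(6, 2) := \matrix_(k, m) (if m == 0 :> nat then a 0 k ^+ 2 else b 0 k ^+ 2).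
pose U := mulmx_ker Q.
have memU w : w \in U <-> \sum_k w 0 k * a 0 k ^+ 2 = 0 /\ \sum_k w 0 k * b 0 k ^+ 2 = 0.
  rewrite mem_mulmx_ker; split=> [/eqP/rowP wQ|[wa wb]].
    have := wQ 0; have := wQ (inord 1); rewrite !mxE => E1 E0.
    split; [rewrite -[RHS]E0|rewrite -[RHS]E1]; apply: eq_bigr => k _;
      by rewrite !mxE ?inordK.
  apply/eqP/rowP => -[[|[|//]] ltm]; rewrite !mxE.
    by rewrite -[RHS]wa; apply: eq_bigr => k _; rewrite !mxE.
  by rewrite -[RHS]wb; apply: eq_bigr => k _; rewrite !mxE.
have dl : \dim l = 2%N by apply/eqP; rewrite El dim_span2; apply: (supported_free aA bA).
have aU : a \in U.
  apply/memU; split; last by apply: big1 => k _; rewrite expr2 mulrA ab mul0r.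
  by rewrite -[RHS]ca (sum_supported aA); apply: eq_bigr => k _; rewrite -exprS.
have bU : b \in U.
  apply/memU; split; first by apply: big1 => k _; rewrite expr2 mulrA [b 0 k * _]mulrC ab mul0r.
  by rewrite -[RHS]cb (sum_supported bA); apply: eq_bigr => k _; rewrite -exprS.
have lU : (l <= U)%VS by rewrite El subv_add -!memvE aU bU.
(* U has codimension at most 2, and it meets the span of e_i and e_j trivially *)
have dU : \dim U = 4%N.
  apply/eqP; rewrite eqn_leq; apply/andP; split; last first.
    by have := dim_mulmx_ker Q; rewrite -/U addn2.
  have eA k (B : {set 'I_6}) : k \in B -> supported B (e k).
    by move=> kB m mB; rewrite mxE /=; case: eqP => // Em; rewrite Em kB in mB.
  have e0 k : e k != 0.
    by apply/eqP => /rowP/(_ k); rewrite !mxE !eqxx => /eqP; rewrite oner_eq0.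
  have de : \dim (<[e i]> + <[e j]>) = 2%N.
    apply/eqP; rewrite dim_span2; apply: (supported_free (eA i A iA)) => //.
    by apply: eA; rewrite inE.
  have Ue : (U :&: (<[e i]> + <[e j]>) = 0)%VS.
    apply/eqP; rewrite -subv0; apply/subvP => w; rewrite memv_cap memv0.
    move=> /andP[/memU[wa wb] /span2P[p [q Ew]]].
    have pq (F : 'I_6 -> K) : \sum_k w 0 k * F k = p * F i + q * F j.
      rewrite -(sum_e i F) -(sum_e j F) !mulr_sumr -big_split /=.
      by apply: eq_bigr => k _; rewrite Ew !mxE; ring.
    move/eqP: wa; rewrite (pq (fun k => a 0 k ^+ 2)) aj expr0n mulr0 addr0.
    rewrite mulf_eq0 expf_eq0 (negPf ai) orbF => /eqP p0.
    move/eqP: wb; rewrite (pq (fun k => b 0 k ^+ 2)) bi expr0n mulr0 add0r.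
    rewrite mulf_eq0 expf_eq0 (negPf bj) orbF => /eqP q0.
    by rewrite Ew p0 q0 !scale0r addr0.
  have := dimvS (subvf (U + (<[e i]> + <[e j]>))%VS).
  by rewrite dimv_disjoint_sum // de dim_rV addn2.
have dC : \dim (U :\: l)%VS = 2%N.
  have := dimv_cap_compl U l; rewrite dU (capv_idPr lU) dl.
  exact: (@addnI 2 _ 2).
have [u [v [_ EC]]] := dim2_line dC.
have UE : (l + (<[u]> + <[v]>) = U)%VS.
  by rewrite -EC addvC addv_diff; apply/addv_idPl.
pose s (k : 'I_3) (m : 'I_6) : {mpoly K[6]} :=
  if k == 0 :> nat then
    if m == i then 'X_j ^+ 2 else if m == j then - 'X_i ^+ 2 else 0
  else (if k == 1 :> nat then u 0 m else v 0 m)%:MP.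
exists s; split=> [k m|x xl x0].
  exists (if k == 0 :> nat then 2%N else 0%N).
    by rewrite (tnth_nth 0); case: k => [[|[|[|//]]] ltk].
  rewrite /s; case: ifP => _; last by rewrite -[_%:MP]mulr1 mul_mpolyC dhomogZ ?dhomog1.
  have X2 k' : ('X_k' ^+ 2 : {mpoly K[6]}) \is 2.-homog.
    by have := @dhomogMn 6 K _ 1 'X_k' 2; rewrite mul1n; apply; rewrite dhomogX /= mdeg1.
  by case: ifP => _ //; case: ifP => _; rewrite ?dhomogN ?dhomog0.
set s0 : 'rV[K]_6 := x 0 j ^+ 2 *: e i - x 0 i ^+ 2 *: e j.
have Es : [seq poly_map (s k) x | k <- enum 'I_3] = [:: s0; u; v].
  rewrite !enum_ordSl enum_ord0 /=; congr [:: _; _; _]; apply/rowP => m; rewrite !mxE /s /=.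
  - have [->|mi] := eqVneq m i.
      have -> : (i == j) = false by apply: contraNF jA => /eqP <-.
      by rewrite rmorphXn /= mevalXU mulr1 mulr0 subr0.
    have [_|mj] := eqVneq m j; rewrite ?mulr0 ?mulr1 ?subr0 ?add0r ?meval0 //.
    by rewrite mevalN rmorphXn /= mevalXU.
  - by rewrite mevalC.
  - by rewrite mevalC.
rewrite /= Es.
have [p [q Ex]] : exists p q, x = p *: a + q *: b by apply/span2P; rewrite -El.
have x2 k : x 0 k ^+ 2 = p ^+ 2 * a 0 k ^+ 2 + q ^+ 2 * b 0 k ^+ 2.
  rewrite Ex !mxE; transitivity (p ^+ 2 * a 0 k ^+ 2 + q ^+ 2 * b 0 k ^+ 2 +
    2%:R * p * q * (a 0 k * b 0 k)); first by ring.
  by rewrite ab mulr0 addr0.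
have sum_x w : \sum_k w 0 k * x 0 k ^+ 2 =
    p ^+ 2 * (\sum_k w 0 k * a 0 k ^+ 2) + q ^+ 2 * (\sum_k w 0 k * b 0 k ^+ 2).
  rewrite !mulr_sumr -big_split; apply: eq_bigr => k _; rewrite x2 /=; ring.
have sum_s0 (F : 'I_6 -> K) : \sum_k s0 0 k * F k = x 0 j ^+ 2 * F i - x 0 i ^+ 2 * F j.
  rewrite -(sum_e i F) -(sum_e j F) !mulr_sumr -sumrB.
  by apply: eq_bigr => k _; rewrite !mxE; ring.
have xi : x 0 i = p * a 0 i by rewrite Ex !mxE bi mulr0 addr0.
have xj : x 0 j = q * b 0 j by rewrite Ex !mxE aj mulr0 add0r.
pose T := mulmx_ker (\col_k x 0 k ^+ 2).
have memT w : w \in T <-> \sum_k w 0 k * x 0 k ^+ 2 = 0.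
  rewrite mem_mulmx_ker; split=> [/eqP/rowP/(_ 0)|wx].
    by rewrite !mxE => E; rewrite -[RHS]E; apply: eq_bigr => k _; rewrite !mxE.
  apply/eqP/rowP => k; rewrite !ord1 !mxE -[RHS]wx.
  by apply: eq_bigr => m _; rewrite !mxE.
have xij : (x 0 i != 0) || (x 0 j != 0).
  apply: contraNT x0; rewrite negb_or !negbK xi xj !mulf_eq0 (negPf ai) (negPf bj) !orbF.
  by move=> /andP[/eqP p0 /eqP q0]; rewrite Ex p0 q0 !scale0r addr0.
have dT : (\dim T <= 5)%N.
  have T6 : (\dim T <= 6)%N by have := dimvS (subvf T); rewrite dim_rV.
  rewrite -ltnS ltn_neqAle T6 andbT.
  apply: contraL xij => /eqP dT; have TT : T = fullv by apply/eqP; rewrite eqEdim subvf dim_rV dT.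
  have /memT : e i \in T by rewrite TT memvf.
  have /memT : e j \in T by rewrite TT memvf.
  rewrite !sum_e => /eqP + /eqP; rewrite !expf_eq0 /= => -> ->; by [].
have s0T : s0 \in T by apply/memT; rewrite (sum_s0 (fun k => x 0 k ^+ 2)) mulrC subrr.
have s0U : s0 \notin U.
  apply/negP => /memU[]; rewrite (sum_s0 (fun k => a 0 k ^+ 2)) (sum_s0 (fun k => b 0 k ^+ 2)).
  rewrite aj bi !expr0n /= !mulr0 subr0 sub0r => /eqP; rewrite mulf_eq0 !expf_eq0 (negPf ai) orbF.
  move=> /eqP xj0 /eqP; rewrite oppr_eq0 mulf_eq0 !expf_eq0 (negPf bj) orbF => /eqP xi0.
  by rewrite xi0 xj0 eqxx in xij.
have UT : (U <= T)%VS.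
  by apply/subvP => w /memU[wa wb]; apply/memT; rewrite sum_x wa wb !mulr0 addr0.
have s00 : s0 != 0 by apply: contraNneq s0U => ->; apply: mem0v.
have dUs : \dim (U + <[s0]>) = 5%N.
  rewrite dimv_disjoint_sum ?dU ?dim_vline ?s00 //.
  apply/eqP; rewrite -subv0; apply/subvP => w; rewrite memv_cap => /andP[wU /vlineP[c Ew]].
  rewrite memv0 Ew; have [->|c0] := eqVneq c 0; first by rewrite scale0r.
  by case/negP: s0U; rewrite -[s0](scalerK c0) memvZ // -Ew.
have ET : (U + <[s0]> = T)%VS.
  by apply/eqP; rewrite eqEdim subv_add UT -memvE s0T dUs.
have Esum : (l + <<[:: s0; u; v]>> = T)%VS.
  by rewrite !span_cons span_nil addv0 -ET -UE (addvC <[s0]>%VS); apply: addvA.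
have size3 : (\dim <<[:: s0; u; v]>> <= 3)%N by apply: dim_span.
have dims := dimv_sum_cap l <<[:: s0; u; v]>>%VS.
rewrite Esum -ET dUs dl in dims.
have [d3 d0] : \dim <<[:: s0; u; v]>> = 3%N /\ \dim (l :&: <<[:: s0; u; v]>>) = 0%N.
  have arith m k : (5 + k = 2 + m -> m <= 3 -> m = 3 /\ k = 0)%N by clear; lia.
  exact: arith dims size3.
split.
- by rewrite /free d3.
- by apply/eqP; rewrite -dimv_eq0 d0.
by move=> w; rewrite Esum; split=> [/memT/tangent_fermat|/tangent_fermat/memT].
Qed.

End SecondType.

(** * Irreducible components of a finite union *)

Lemma components_of_finite_union (T : Type) (closed : set (set T)) (S : set T) (I : finType)
    (C : I -> set T) :
    closed set0 -> (forall A B, closed A -> closed B -> closed (A `|` B)) ->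
    (forall i, closed (C i)) -> (forall i, irreducible closed (C i)) ->
    (forall i j, C i `<=` C j -> i = j) -> S = \bigcup_i C i ->
  irreducible_components closed S = range C.
Proof.
move=> closed0 closedU clC irrC anti ES.
have CS i : C i `<=` S by rewrite ES => x Cx; exists i.
have one (Z : set T) : irreducible closed Z -> Z `<=` S -> exists i, Z `<=` C i.
  move=> [[z Zz] irrZ] ZS.
  pose U (s : seq I) := foldr (fun i X => C i `|` X) set0 s.
  have clU s : closed (U s) by elim: s => //= i s IH; apply: closedU.
  have sub s : Z `<=` U s -> exists i, Z `<=` C i.
    elim: s => [/(_ z Zz)//|i s IH] /(irrZ _ _ (clC i) (clU s))[Zi|/IH//].
    by exists i.
  apply: (sub (enum I)) => x /ZS; rewrite ES => -[i _ Cx].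
  have : i \in enum I by rewrite mem_enum.
  elim: (enum I) => //= j s IH; rewrite inE => /orP[/eqP <-|/IH Ux]; [by left|by right].
apply/seteqP; split=> [Z [ZS irrZ maxZ]|_ [i _ <-]].
  have [i Zi] := one Z irrZ ZS; exists i => //.
  exact: maxZ.
split=> // Z' Z'S irrZ' iZ'; have [j Z'j] := one Z' irrZ' Z'S.
have ij := anti i j (subset_trans iZ' Z'j); rewrite -ij in Z'j.
by apply/seteqP.
Qed.

(** * Closed sets of lines: unions and points *)

Section GrassUnion.
Variables (K : closedFieldType) (n : nat).

Lemma grass_closed0 : grass_closed (set0 : set (linsp K n)).
Proof.
exists [set 1]; apply/seteqP; split=> // l [_ /(_ 1 0 0 erefl (mem0v _) (mem0v _))/eqP].
by rewrite meval1 oner_eq0.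
Qed.

(** Products of equations define the union.  Equations P1 and P2 that fail on a line
    fail at possibly different multiples of its Pluecker vector; as K is infinite,
    both fail at a common multiple. *)
Lemma grass_closedU (C1 C2 : set (linsp K n)) :
  grass_closed C1 -> grass_closed C2 -> grass_closed (C1 `|` C2).
Proof.
move=> [J1 ->] [J2 ->]; exists [set P | exists P1 P2, [/\ J1 P1, J2 P2 & P = P1 * P2]].
apply/seteqP; split=> [l [] [dl H]|l [dl H]].
- by split=> // _ u v [P1 [P2 [J1P J2P ->]]] ul vl; rewrite mevalM H // mul0r.
- by split=> // _ u v [P1 [P2 [J1P J2P ->]]] ul vl; rewrite mevalM (H P2) // mulr0.
have [a [b [fr El]]] := dim2_line dl.
apply: contrapT => /not_orP[n1 n2].
have bad (J : set {mpoly K[n * n]}) : ~ grass_zeros J l -> exists2 P, J P &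
    exists2 g : {poly K}, g != 0 & forall c, g.[c] = P.@[mxvec (c *: pluecker a b) 0].
  rewrite El => /(grass_zeros_span2 J fr)/existsNP[P /existsNP[c /not_implyP[JP /eqP Pc]]].
  exists P => //; have [g gE] := restrict_line P 0 (mxvec (pluecker a b)).
  have {}gE d : g.[d] = P.@[mxvec (d *: pluecker a b) 0] by rewrite gE add0r linearZ.
  by exists g => //; apply: contraNneq Pc => g0; rewrite -gE g0 horner0.
have [P1 J1P [g1 g10 g1E]] := bad J1 n1; have [P2 J2P [g2 g20 g2E]] := bad J2 n2.
have /closed_nonrootP[c] : g1 * g2 != 0 by rewrite mulf_neq0.
rewrite rootE hornerM g1E g2E -mevalM => /eqP[].
have := pluecker_comb a b c 0 0 1; rewrite mulr1 mul0r subr0 => <-.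
by apply: H; rewrite ?El; [exists P1, P2|apply/span2P; exists c, 0|apply/span2P; exists 0, 1].
Qed.

Lemma point_closed (x : linsp K n) : \dim x = 1%N -> proj_closed [set x].
Proof.
move=> /dim1_line[a a0 ->]; have /rV0Pn[i ai] := a0.
exists [set a 0 i *: 'X_j - a 0 j *: 'X_i | j in setT].
apply/seteqP; split=> [_ ->|y [/dim1_line[v v0 ->] H]].
  apply/zeros_line => // _ c [j _ <-].
  by rewrite mevalB !mevalZ !mevalXU !mxE; ring.
have Ev : v = (v 0 i / a 0 i) *: a.
  apply/rowP => j; have := H _ v (ex_intro2 _ _ j I erefl) (memv_line v).
  rewrite mevalB !mevalZ !mevalXU !mxE => /eqP; rewrite subr_eq0 => /eqP E.
  by rewrite mulrAC [v 0 i * _]mulrC -E mulrAC divff // mul1r.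
apply/eqP; rewrite eqEdim !dim_vline v0 a0 /= -memvE andbT Ev memvZ ?memv_line //.
Qed.

Lemma point_irreducible (closed : set (set (linsp K n))) x : irreducible closed [set x].
Proof.
by split=> [|A B _ _ /(_ x erefl)[Ax|Bx]]; [exists x|left=> _ ->|right=> _ ->].
Qed.
End GrassUnion.

(** * The 55 components *)

(** Each pair of complementary 3-subsets of a 6-set has one member containing 0. *)
Lemma card_fixed_point_3sets : #|[set A : {set 'I_6} | (#|A| == 3%N) && (ord0 \in A)]%SET| = 10%N.
Proof.
set D := [set A | _]%SET; pose compl (A : {set 'I_6}) := ~: A.
have cD : #|compl @: D| = #|D| by apply: card_imset; exact: finset.setC_inj.
have disj : D :&: compl @: D = finset.set0.
  apply/setP => A; rewrite inE [RHS]inE; apply/negP => /andP[].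
  rewrite inE => /andP[_ A0] /imsetP[B].
  by rewrite inE => /andP[_ B0] EA; rewrite EA inE B0 in A0.
have all3 : D :|: compl @: D = [set A : {set 'I_6} | #|A| == 3%N]%SET.
  apply/setP => A; rewrite !inE; have [A0|A0] /= := boolP (ord0 \in A).
    rewrite andbT; case: eqP => //= A3; apply/negP => /imsetP[B]; rewrite inE => /andP[_ B0] EA.
    by rewrite EA inE B0 in A0.
  have cA := finset.cardsC A; rewrite card_ord in cA.
  rewrite andbF /=; apply/imsetP/eqP => [[B]|A3].
    rewrite inE => /andP[/eqP B3 _] EA; move: cA; rewrite EA /compl finset.setCK B3.
    by move/(@addIn 3 _ 3).
  exists (~: A); last by rewrite /compl finset.setCK.
  by rewrite !inE A0 andbT -(eqn_add2l 3) -{1}A3 cA.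
have := card_draws 'I_6 3; rewrite -all3 cardsU disj cards0 subn0 cD card_ord.
by rewrite addnn => /(congr1 half); rewrite doubleK => ->.
Qed.

Section Main.
Variable K : closedFieldType.
Hypotheses (two0 : 2%:R != 0 :> K) (three0 : 3%:R != 0 :> K).
Implicit Types (A : {set 'I_6}) (v w y z : 'rV[K]_6).

Lemma fermat_cone_delta A i j : i \in A -> j \in A -> i != j ->
  forall c : K, c ^+ 3 = 1 ->
  fermat_cone A (delta_mx 0 i - c *: delta_mx 0 j) /\
  delta_mx 0 i - c *: delta_mx 0 j != 0 :> 'rV[K]_6.
Proof.
move=> iA jA ij c c3; split; last first.
  apply/eqP => /rowP/(_ i); rewrite !mxE !eqxx (negPf ij) mulr0 subr0 => /eqP.
  by rewrite oner_eq0.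
have sA : supported A (delta_mx 0 i - c *: delta_mx 0 j : 'rV[K]_6).
  move=> k kA; have ki : k != i by apply: contraNneq kA => ->.
  have kj : k != j by apply: contraNneq kA => ->.
  by rewrite !mxE (negPf ki) (negPf kj) mulr0 subr0.
split=> //; rewrite (sum_supported sA) (bigD1 i) //= (bigD1 j) 1?eq_sym //= big1 => [|k].
  rewrite !mxE !eqxx (negPf ij) (eq_sym j) (negPf ij) /=.
  by transitivity (1 - c ^+ 3); [ring|rewrite c3 subrr].
by move=> /andP[ki kj]; rewrite !mxE (negPf ki) (negPf kj) mulr0 subr0 expr0n.
Qed.

Lemma vertices_nonempty A : (2 <= #|A|)%N -> exists v, v != 0 /\ fermat_cone A v.
Proof.
move=> /card_gt1P[i [j [iA jA ij]]].
have [cv v0] := fermat_cone_delta iA jA ij (expr1n _ 3).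
by exists (delta_mx 0 i - 1 *: delta_mx 0 j).
Qed.

Lemma vertex_full A v : #|A| = 2%N -> fermat_cone A v -> v != 0 ->
  forall i, i \in A -> v 0 i != 0.
Proof.
move=> A2 [vA v0] vn0 i iA; apply/negP => /eqP vi.
have : fermat_cone (A :\ i) v.
  split=> [j|]; last by rewrite (big_setD1 i) //= vi expr0n add0r in v0.
  by rewrite !inE negb_and negbK => /orP[/eqP->|/vA].
have Ai1 : #|A :\ i| = 1%N by have := cardsD1 i A; rewrite iA A2 => -[].
by move=> /fermat_cone_card/(_ vn0)/leq_trans/(_ (eq_leq Ai1)).
Qed.

Lemma primitive_cube_root : exists w : K, [/\ w ^+ 3 = 1, w != 1, w ^+ 2 != 1 & w ^+ 2 != w].
Proof.
have [w Ew] := @solve_monicpoly K 2 (fun=> -1) isT.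
have {}Ew : w ^+ 2 = - w - 1.
  by rewrite Ew !big_ord_recl big_ord0 /= expr0 expr1; ring.
have w3 : w ^+ 3 = 1 by rewrite exprS Ew mulrDr mulrN -expr2 Ew; ring.
have w1 : w != 1.
  apply: contraNneq three0 => w1; move/eqP: Ew; rewrite w1 -subr_eq0 expr1n => /eqP E.
  by apply/eqP; rewrite -[RHS]E; ring.
have w0 : w != 0 by apply: contra_eq_neq w3 => ->; rewrite expr0n eq_sym oner_eq0.
exists w; split=> //.
  by apply: contraNneq w1 => w2; rewrite exprS w2 mulr1 in w3; apply/eqP.
by apply: contraNneq w1 => w2; apply/eqP/(mulfI w0); rewrite mulr1 -expr2.
Qed.

(** The vertices for A = {i, j} are the three points e_i - w^k e_j, for w a primitive
    cube root of 1; a map from three elements onto them is injective. *)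
Lemma vertices_enum_inj A (q : 'I_3 -> linsp K 6) : #|A| = 2%N ->
  [set q mu | mu in [set: 'I_3]] = vertices K A -> injective q.
Proof.
move=> A2 Eq; have /card_gt1P[i [j [iA jA ij]]] : (1 < #|A|)%N by rewrite A2.
have [w [w3 w1 w21 w2w]] := primitive_cube_root.
have sw : ((1 == w) = false) * ((1 == w ^+ 2) = false) * ((w == w ^+ 2) = false).
  by rewrite !(eq_sym _ (w ^+ 2)) (eq_sym 1) (negPf w1) (negPf w21) (negPf w2w).
pose vtx (k : 'I_3) : 'rV[K]_6 := delta_mx 0 i - w ^+ k *: delta_mx 0 j.
have vtxP k : fermat_cone A (vtx k) /\ vtx k != 0.
  by apply: fermat_cone_delta => //; rewrite exprAC w3 expr1n.
have vtx_inj k m : <[vtx k]>%VS = <[vtx m]>%VS -> k = m.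
  move=> E; have /vlineP[c /rowP Ec] : vtx k \in <[vtx m]>%VS by rewrite -E memv_line.
  have := Ec i; have := Ec j; rewrite !mxE !eqxx (negPf ij) (eq_sym j) (negPf ij) /=.
  rewrite !mulr0 !subr0 !sub0r !mulr1 => + c1; rewrite -c1 mul1r => /oppr_inj.
  case: k {E Ec} => [[|[|[|//]]] ltk]; case: m => [[|[|[|//]]] ltm] /=;
    rewrite ?expr0 ?expr1 => /eqP; rewrite ?(negPf w1) ?(negPf w21) ?(negPf w2w) ?sw //;
    by move=> _; apply: val_inj.
have vtx_q k : exists m, q m = <[vtx k]>%VS.
  have [cv v0] := vtxP k; have : vertices K A <[vtx k]>%VS by apply/vertices_line.
  by rewrite -Eq => -[m _ <-]; exists m.
have [s sE] := choice vtx_q.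
have /injF_bij[s' _ s'K] : injective s.
  by move=> k m Ekm; apply: vtx_inj; rewrite -!sE Ekm.
by move=> k m; rewrite -(s'K k) -(s'K m) !sE => /vtx_inj->.
Qed.

(** If one of the components of x on A and off A is zero, any point of the
    corresponding Fermat variety completes x to a line. *)
Lemma VA_points A x : (2 <= #|A|)%N -> (2 <= #|~: A|)%N ->
  VA K A x <-> exists l, [/\ join (vertices K A) (vertices K (~: A)) l, \dim x = 1%N & (x <= l)%VS].
Proof.
move=> A2 A'2; split=> [[[dx Hf] [_ Hc]]|[l [jl dx xl]]].
  have [v v0 Ex] := dim1_line dx; have vx : v \in x by rewrite Ex memv_line.
  have f0 := Hf _ v erefl vx; have c0 := Hc _ v erefl vx.
  rewrite meval_fermat in f0; rewrite meval_cubes in c0.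
  have pick_cone (B : {set 'I_6}) : (2 <= #|B|)%N -> \sum_(i in B) v 0 i ^+ 3 = 0 ->
      exists a, [/\ a != 0, fermat_cone B a & part B v \in <[a]>%VS].
    move=> B2 B0; have [pB|pB] := eqVneq (part B v) 0.
      by have [a [a0 ca]] := vertices_nonempty B2; exists a; rewrite pB mem0v.
    exists (part B v); split; rewrite ?memv_line //; split=> [i iB|].
      by rewrite mxE (negPf iB).
    by rewrite -[RHS]B0; apply: eq_bigr => i iB; rewrite mxE iB.
  have c'0 : \sum_(i in ~: A) v 0 i ^+ 3 = 0.
    move: f0; rewrite (bigID (mem A)) /= c0 add0r => E; rewrite -[RHS]E.
    by apply: eq_bigl => i; rewrite inE.
  have [a [a0 ca av]] := pick_cone A A2 c0; have [b [b0 cb bv]] := pick_cone _ A'2 c'0.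
  exists (<[a]> + <[b]>)%VS; split=> //.
    by exists <[a]>%VS, <[b]>%VS; split=> //; apply/vertices_line.
  rewrite Ex -memvE; suff -> : v = part A v + part (~: A) v by apply: memv_add.
  by apply/rowP => i; rewrite !mxE inE; case: ifP; rewrite ?addr0 ?add0r.
have [_ fl] := join_fano (fun _ => id) (fun _ => id) jl.
split; split=> // _ v -> vx; have vl := subvP xl v vx; first exact: fl.
have [a [b [a0 _ aA bA [/(vertices_line _ a0) ca _ El]]]] :=
  join_rep (@vertices_lies_in K A) (@vertices_lies_in K (~: A)) jl.
move: vl; rewrite El => /span2P[p [q ->]].
rewrite meval_cubes -[RHS](fermat_coneZ p ca).2; apply: eq_bigr => i iA.
by rewrite !mxE (bA i) ?mulr0 ?addr0 // inE iA.
Qed.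

Section Components.
Variable p : {set 'I_6} -> 'I_3 -> linsp K 6.
Hypothesis hp : forall A : {set 'I_6}, #|A| = 2%N ->
  [set p A mu | mu in [set: 'I_3]] = vertices K A.

Let vertex_p A mu : #|A| = 2%N -> vertices K A (p A mu).
Proof. by move=> A2; rewrite -(hp A2); exists mu. Qed.

(** A and its complement define the same component when #|A| = 3; the condition that
    A contains 0 selects one of them. *)
Definition component_index : finType :=
  ({A : {set 'I_6} | (#|A| == 3%N) && (ord0 \in A)} + {A : {set 'I_6} | #|A| == 2%N} * 'I_3)%type.

Definition component_support (t : component_index) : {set 'I_6} :=
  match t with inl A => val A | inr (A, mu) => val A end.

Definition component_base (t : component_index) : set (linsp K 6) :=
  match t with inl A => vertices K (val A) | inr (A, mu) => [set p (val A) mu] end.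

Definition component (t : component_index) : set (linsp K 6) :=
  join (component_base t) (vertices K (~: component_support t)).

Lemma component_base_sub t : component_base t `<=` vertices K (component_support t).
Proof. by case: t => [A //|[[A /= /eqP A2] mu] _ ->]; apply: vertex_p. Qed.

Lemma component_base_lies_in t : lies_in (component_support t) (component_base t).
Proof. by move=> x /component_base_sub; apply: vertices_lies_in. Qed.

Lemma component_closed t : grass_closed (component t).
Proof.
apply: (join_grass_closed (@component_base_lies_in t) (@vertices_lies_in _ _)).
  case: t => [A|[A mu]] /=; first exact: vertices_closed.
  by apply: point_closed; have [] := @vertices_lies_in K _ _ (vertex_p mu (eqP (valP A))).
exact: vertices_closed.
Qed.

Lemma card_setC6 A : (#|A| + #|~: A| = 6)%N.
Proof. by rewrite finset.cardsC card_ord. Qed.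

Lemma card_component_support t : #|component_support t| = 3%N \/ #|component_support t| = 2%N.
Proof. by case: t => [[A /= /andP[/eqP A3 _]]|[[A /= /eqP A2] _]]; [left|right]. Qed.

Lemma card_component_supportC t : (3 <= #|~: component_support t| <= 4)%N.
Proof.
have := card_setC6 (component_support t).
by case: (card_component_support t) => -> /eqP; [rewrite (eqn_add2l 3 _ 3)|rewrite (eqn_add2l 2 _ 4)];
  move=> /eqP->.
Qed.

Lemma component_irreducible t : irreducible (@grass_closed K 6) (component t).
Proof.
apply: (join_irreducible (@component_base_lies_in t) (@vertices_lies_in _ _)).
  case: t => [[A /= /andP[/eqP A3 _]]|[A mu]] /=; last exact: point_irreducible.
  by apply: vertices_irreducible => //; rewrite A3.
by apply: vertices_irreducible => //; apply: card_component_supportC.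
Qed.

Lemma component_generic_line t : exists a b,
  [/\ component_base t <[a]>%VS, component t (<[a]> + <[b]>)%VS,
      supported (component_support t) a, supported (~: component_support t) b &
      (forall i, i \in component_support t -> a 0 i != 0) /\
      (forall i, i \notin component_support t -> b 0 i != 0)].
Proof.
have [b [cb b_full _]] := generic_cone_point two0 three0 (card_component_supportC t).
have [k kA] : exists k, k \in ~: component_support t.
  by apply/card_gt0P; have := card_component_supportC t; case: #|_|.
have b0 : b != 0 by apply: contraNneq (b_full k kA) => ->; rewrite mxE.
have Vb : vertices K (~: component_support t) <[b]>%VS by apply/vertices_line.
suff [a [Ba [aA a_full]]] : exists a, component_base t <[a]>%VS /\
    supported (component_support t) a /\ forall i, i \in component_support t -> a 0 i != 0.
  exists a, b; split=> //; first by exists <[a]>%VS, <[b]>%VS.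
    by case: cb.
  by split=> // i iA; apply: b_full; rewrite inE.
case: t {k kA cb b_full Vb} => [[A /= /andP[/eqP A3 A0]]|[[A /= /eqP A2] mu]] /=.
  have [|a [ca a_full _]] := generic_cone_point two0 three0 (A := A); first by rewrite A3.
  exists a; split; last by split=> //; case: ca.
  apply/vertices_line => //.
  by apply: contraNneq (a_full _ A0) => ->; rewrite mxE.
have /verticesP[a [a0 Ea ca]] := vertex_p mu A2.
by exists a; rewrite Ea; split=> //; split; [case: ca|exact: vertex_full].
Qed.

(** A generic line of a component determines the subset A up to complement, hence
    exactly: complements have another size, or are 3-subsets that miss 0.  When
    #|A| = 2 it also determines the vertex, as its only point supported on A. *)
Lemma component_antichain t t' : component t `<=` component t' -> t = t'.
Proof.
move=> tt'; have [a [b [Ba /tt' jl aA bA [a_full b_full]]]] := component_generic_line t.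
have [i iA] : exists i, i \in component_support t.
  by apply/card_gt0P; case: (card_component_support t) => ->.
have [j jA] : exists j, j \in ~: component_support t.
  by apply/card_gt0P; have := card_component_supportC t; case: #|_|.
rewrite inE in jA.
have [a0 b0] : a != 0 /\ b != 0.
  by split; [apply: contraNneq (a_full i iA)|apply: contraNneq (b_full j jA)] => ->; rewrite mxE.
have base' : component_support t' = component_support t -> component_base t' <[a]>%VS.
  move=> EA; have Y' := @component_base_lies_in t'; rewrite EA in Y'.
  rewrite /component EA in jl.
  have [a' [b' [_ _ a'A b'A [Ya' _ El]]]] := join_rep Y' (@vertices_lies_in _ _) jl.
  have /span2P[r [s Ea]] : a \in (<[a']> + <[b']>)%VS.
    by rewrite -El; apply/span2P; exists 1, 0; rewrite scale1r scale0r addr0.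
  have [pa _] := part_comb r s a'A b'A; rewrite -Ea in pa.
  have {}pa : a = r *: a'.
    by rewrite -pa; apply/rowP => k; rewrite mxE; case: ifPn => // /aA.
  suff -> : <[a]>%VS = <[a']>%VS by [].
  apply/eqP; rewrite eqEdim -memvE pa memvZ ?memv_line //= -pa !dim_vline a0.
  by rewrite leq_b1.
have card3 (B : {A : {set 'I_6} | (#|A| == 3%N) && (ord0 \in A)}) : #|sval B| = 3%N.
  by case: B => B /= /andP[/eqP].
have card2 (B : {A : {set 'I_6} | #|A| == 2%N}) : #|sval B| = 2%N by case: B => B /= /eqP.
have in0 (B : {A : {set 'I_6} | (#|A| == 3%N) && (ord0 \in A)}) : ord0 \in sval B.
  by case: B => B /= /andP[].
case: (generic_join_parts (@component_base_lies_in t') (@vertices_lies_in _ _)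
  aA bA a_full b_full iA jA jl) => EA.
- have := Ba; have := base' EA; move: EA; case: t t' {Ba tt' aA bA a_full b_full iA jA jl base'} => [A|[A mu]] [A'|[A' mu']] /=.
  + by move=> /val_inj->.
  + by move=> /(congr1 (fun B : {set 'I_6} => #|B|)); rewrite card3 card2.
  + by move=> /(congr1 (fun B : {set 'I_6} => #|B|)); rewrite card3 card2.
  + move=> /val_inj EA Ep' Ep; rewrite EA in Ep' *.
    by rewrite (vertices_enum_inj (eqP (valP A)) (hp (eqP (valP A))) (etrans (esym Ep') Ep)).
exfalso; move: EA; case: t t' {Ba tt' aA bA a_full b_full iA jA jl base'} => [A|[A mu]] [A'|[A' mu']] /= EA.
- by have := in0 A'; rewrite EA inE in0.
- by have := card_setC6 (sval A); rewrite -EA card2 card3.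
- by have := card_setC6 (sval A); rewrite -EA card2 card3.
- by have := card_setC6 (sval A); rewrite -EA !card2.
Qed.

Lemma card_component_index : #|component_index| = 55%N.
Proof.
rewrite card_sum card_prod card_ord !card_sig.
have -> : #|[pred A : {set 'I_6} | (#|A| == 3%N) && (ord0 \in A)]| = 10%N.
  by rewrite -card_fixed_point_3sets; apply: eq_card => A; rewrite !inE.
have -> // : #|[pred A : {set 'I_6} | #|A| == 2%N]| = 15%N.
rewrite (_ : 15%N = 'C(#|'I_6|, 2)%N); last by rewrite card_ord.
by rewrite -card_draws; apply: eq_card => A; rewrite !inE.
Qed.

Lemma range_component : range component =
  [set S3 K A | A in [set A : {set 'I_6} | #|A| = 3%N]] `|`
  [set S2 A.1 (p A.1 A.2) | A in [set A : {set 'I_6} * 'I_3 | #|A.1| = 2%N]].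
Proof.
apply/seteqP; split=> [_ [[A|[A mu]] _ <-]|C].
- by left; exists (val A); [have /andP[/eqP] := valP A|rewrite S3E].
- have /eqP A2 := valP A; right; exists (val A, mu) => //=.
  by rewrite S2E //; apply: vertex_p.
case=> [[A /= A3 <-]|[[A mu] /= A2 <-]]; last first.
  have hA : #|A| == 2%N by apply/eqP.
  by exists (inr (exist _ A hA, mu)) => //; rewrite S2E //; apply: vertex_p.
rewrite S3E; have [A0|A0] := boolP (ord0 \in A).
  have hA : (#|A| == 3%N) && (ord0 \in A) by rewrite A3.
  by exists (inl (exist _ A hA)).
have hA : (#|~: A| == 3%N) && (ord0 \in ~: A).
  by rewrite inE A0 andbT; have := card_setC6 A; rewrite A3 => /(@addnI 3 _ 3)->.
by exists (inl (exist _ (~: A) hA)); rewrite // /component /= finset.setCK join_sym.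
Qed.

Lemma second_typeE : second_type (fermat K) = \bigcup_t component t.
Proof.
apply/seteqP; split=> [l /(second_type_join two0 three0)[A cA jl]|l [t _ [y [z [By Vz El]]]]].
  have [C [t _ <-] Cl] : exists2 C, range component C & C l.
    rewrite range_component; case: cA => cA.
      by exists (S3 K A); [left; exists A|rewrite S3E].
    have [y [z [Vy Vz El]]] := jl.
    have [mu _ Emu] : [set p A mu | mu in [set: 'I_3]] y by rewrite hp.
    exists (S2 A (p A mu)); first by right; exists (A, mu).
    by rewrite S2E ?Emu //; exists y, z.
  by exists t.
apply: (join_second_type three0 (A := component_support t)).
by exists y, z; split=> //; apply: component_base_sub.
Qed.

Theorem fermat_second_type :
  let F6 := fermat K in
  let S := second_type F6 in
  let W := second_type_locus F6 in
  let components :=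
    [set S3 K A | A in [set A : {set 'I_6} | #|A| = 3%N]] `|`
    [set S2 A.1 (p A.1 A.2) |
       A in [set A : {set 'I_6} * 'I_3 | #|A.1| = 2%N]] in
  [/\ W = (\bigcup_(A in [set A : {set 'I_6} | #|A| = 3%N]) VA K A) `|`
          (\bigcup_(A in [set A : {set 'I_6} | #|A| = 2%N]) VA K A),
      S = (\bigcup_(A in [set A : {set 'I_6} | #|A| = 3%N]) S3 K A) `|`
          (\bigcup_(A in [set A : {set 'I_6} | #|A| = 2%N])
             \bigcup_(mu in [set: 'I_3]) S2 A (p A mu)),
      irreducible_components (@grass_closed K 6) S = components,
      (components #= `I_(3 * 15 + 10)%N)%card &
      forall S', components S' ->
        generically_degree_one (over_lines F6 S')].
Proof.
move=> F6 S W components; have Ecomp : components = range component.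
  by rewrite range_component.
have ES : S = \bigcup_t component t by apply: second_typeE.
have cards A : #|A| = 3%N \/ #|A| = 2%N -> (2 <= #|A|)%N /\ (2 <= #|~: A|)%N.
  have := card_setC6 A => + [] A_; rewrite A_ => /eqP.
    by rewrite (eqn_add2l 3 _ 3) => /eqP->.
  by rewrite (eqn_add2l 2 _ 4) => /eqP->.
split.
- have locus x : W x <-> exists2 A : {set 'I_6}, #|A| = 3%N \/ #|A| = 2%N & VA K A x.
    split=> [[[l x'] [[/= _ dx xl] Sl] /= <-]|[A cA Vx]].
      have [A cA jl] := second_type_join two0 three0 Sl; exists A => //.
      by have [A2 A'2] := cards A cA; apply/VA_points => //; exists l.
    have [A2 A'2] := cards A cA; have [l [jl dx xl]] := (VA_points x A2 A'2).1 Vx.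
    have Sl := join_second_type three0 jl; exists (l, x) => //; split=> //.
    by split=> //; case: Sl.
  apply/seteqP; split=> [x /locus[A [A3|A2] Vx]|x [[A A3 Vx]|[A A2 Vx]]].
  + by left; exists A.
  + by right; exists A.
  + by apply/locus; exists A => //; left.
  + by apply/locus; exists A => //; right.
- rewrite ES; have -> : \bigcup_t component t = \bigcup_(C in components) C.
    by rewrite Ecomp bigcup_image.
  rewrite bigcup_setU !bigcup_image; congr (_ `|` _).
  apply/seteqP; split=> l.
    by case=> -[A mu] /= A2 Sl; exists A => //; exists mu.
  by case=> A A2 [mu _ Sl]; exists (A, mu).
- rewrite Ecomp; apply: components_of_finite_union ES; [exact: grass_closed0|exact: grass_closedU
    |exact: component_closed|exact: component_irreducible|exact: component_antichain].
- rewrite Ecomp; apply: card_eq_trans (inj_card_eq _) _.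
    by move=> t t' _ _ E; apply: component_antichain; rewrite E.
  have rank_im : enum_rank @` [set: component_index] = [set: 'I_#|component_index|].
    by apply/seteqP; split=> // k _; exists (enum_val k) => //; apply: enum_valK.
  apply: card_eq_trans (card_esym (inj_card_eq (f := enum_rank) _)) _.
    by move=> t t' _ _; apply: enum_rank_inj.
  by rewrite rank_im card_component_index; apply: card_esym; apply: card_II.
move=> S'; rewrite Ecomp => -[t _ <-].
apply: (join_generically_degree_one (@component_base_lies_in t) (@vertices_lies_in _ _)).
exact: join_fano (@component_base_sub t) (fun _ => id).
Qed.

End Components.
End Main.

Theorem proposition3p5 (R : realType)
    (p : {set 'I_6} -> 'I_3 -> linsp R[i] 6)
    (hp : forall A : {set 'I_6}, #|A| = 2%N ->
            [set p A mu | mu in [set: 'I_3]] = vertices R[i] A) :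
  let F6 := fermat R[i] in
  let S := second_type F6 in
  let W := second_type_locus F6 in
  let components :=
    [set S3 R[i] A | A in [set A : {set 'I_6} | #|A| = 3%N]] `|`
    [set S2 A.1 (p A.1 A.2) |
       A in [set A : {set 'I_6} * 'I_3 | #|A.1| = 2%N]] in
  [/\ W = (\bigcup_(A in [set A : {set 'I_6} | #|A| = 3%N]) VA R[i] A) `|`
          (\bigcup_(A in [set A : {set 'I_6} | #|A| = 2%N]) VA R[i] A),
      S = (\bigcup_(A in [set A : {set 'I_6} | #|A| = 3%N]) S3 R[i] A) `|`
          (\bigcup_(A in [set A : {set 'I_6} | #|A| = 2%N])
             \bigcup_(mu in [set: 'I_3]) S2 A (p A mu)),
      irreducible_components (@grass_closed R[i] 6) S = components,
      (components #= `I_(3 * 15 + 10)%N)%card &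
      forall S', components S' ->
        generically_degree_one (over_lines F6 S')].
Proof.
have nat0 m : m.+1%:R != 0 :> R[i] by rewrite Num.Theory.pnatr_eq0.
exact: (fermat_second_type (nat0 1%N) (nat0 2%N) hp).
Qed.
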